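(* Let $\gamma\in\mathcal M_g$ be an arc-length parametrized curve with monodromy $g=(R,\vec b)\in\mathrm{SE}(3)$, and choose the origin on the screw axis of $g$ whenever $R\neq\mathrm{Id}$. Then $\gamma$ is elastic if and only if it is a critical point of the length $\mathscr L$ on $\mathcal M_g$ at fixed well-defined components of the area and volume vectors, where the well-defined components are: - if $g=\mathrm{id}$: the full vectors $\mathscr A$ and $\mathscr V$; - if $R=\mathrm{Id}$ and $\vec b\ne0$: the full vector $\mathscr A$ and the component $\langle\vec s_g,\mathscr V\rangle$; - if $R\ne\mathrm{Id}$: the components $\langle\vec s_g,\mathscr A\rangle$ and $\langle\vec s_g,\mathscr V\rangle$.
   Context: Fix a translation $\tau:\mathbb R\to\mathbb R$, $\tau(t)=t+T_0$ with $T_0>0$. An element $g=(R,\vec b)\in\mathrm{SE}(3)$, $R\in \mathrm{SO}(3)$, $\vec b\in\mathbb R^3$, acts by $g(\vec x)=R\vec x+\vec b$. $\mathcal M_g$ is the space of smooth immersions $\gamma:\mathbb R\to\mathbb R^3$ with $\gamma(\tau(t))=g(\gamma(t))$ for all $t$ ($\vec\gamma$ denotes the corresponding vector-valued function). Its tangent space $T_\gamma\mathcal M_g$ consists of smooth $X:\mathbb R\to\mathbb R^3$ with $X(\tau(t))=R\,X(t)$. A fundamental domain is an interval $I=[t_0,\tau(t_0)]$, $t_0\in\mathbb R$. $ds=|\partial_t\vec\gamma|\,dt$ is the arc-length measure and $'$ the arc-length derivative; a curve is arc-length parametrized if $|\partial_t\vec\gamma|=1$. If $R\ne\mathrm{Id}$,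 the origin is chosen on the screw axis of $g$, so that $R\vec b=\vec b$; $\vec s_g$ is a unit vector with $R\vec s_g=\vec s_g$, and $\vec b$ is parallel to $\vec s_g$. If $R=\mathrm{Id}$, $\vec b\neq0$, then $\vec s_g=\vec b/|\vec b|$. Functionals, evaluated on a fundamental domain $I=[t_0,\tau(t_0)]$: $\mathscr L(\gamma)=\int_I ds$, $\mathscr A(\gamma)=\tfrac12\int_I\vec\gamma\times\vec\gamma'\,ds-\tfrac12\vec b\times\vec\gamma(t_0)$, $\mathscr V(\gamma)=\tfrac13\int_I\vec\gamma\times(\vec\gamma\times\vec\gamma')\,ds-\tfrac16\vec\gamma(t_0)\times(\vec b\times\vec\gamma(t_0))$. The components listed in the claim do not depend on the choice of $I$. Critical at fixed values of finitely many functionals $F_1,\dots,F_k$ means: $d\mathscr L_\gamma(X)=0$ for every $X\in T_\gamma\mathcal M_g$ with $dF_{j,\gamma}(X)=0$ for all $j$; equivalently, $\mathscr L$ plus some linear combination of the $F_j$ is stationary at $\gamma$ for all variations in $T_\gamma\mathcal M_g$. Elastic: an arc-length parametrized curve $\gamma$ is elastic if it is a critical point, under compactly supported variations, of the bending energy $\tfrac12\int|\vec\gamma''|^2ds$ under the constraints of fixed length and fixed holonomy (total torsion); that is, there are constants $\lambda_1,\lambda_2\in\mathbb R$ such that $$\vec\gamma''''+\tfrac32\langle\vec\gamma'',\vec\gamma''\rangle\vec\gamma''-\langle\vec\gamma'''',\vec\gamma'\rangle\vec\gamma'-\lambda_1\vec\gamma''-\lambda_2\,\vec\gamma'\times\vec\gamma'''=0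 .$$ *)

(* Defs.v *)
From mathcomp Require Import all_boot all_order all_algebra.
From mathcomp Require Import all_classical all_reals all_analysis.

Set Implicit Arguments.
Unset Strict Implicit.
Unset Printing Implicit Defensive.

Import Order.TTheory GRing.Theory Num.Theory.
Import numFieldNormedType.Exports.

Local Open Scope classical_set_scope.
Local Open Scope ring_scope.

Definition dot {R : realType} (u v : 'cV[R]_3) : R := \sum_i u i 0 * v i 0.

(* The library norm `|u| on matrices is the sup norm, not the Euclidean one. *)
Definition enorm {R : realType} (u : 'cV[R]_3) : R := Num.sqrt (dot u u).

(* Row indices are added cyclically, 'I_3 being the ring Z/3. *)
Definition cross {R : realType} (u v : 'cV[R]_3) : 'cV[R]_3 :=
  \col_(i < 3) (u (i + 1) 0 * v (i + 2) 0 - u (i + 2) 0 * v (i + 1) 0).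

Definition SO3 {R : realType} (Q : 'M[R]_3) : Prop :=
  Q *m Q^T = 1%:M /\ \det Q = 1.

(* (Q, b) stands for the element (R, b) of SE(3). *)
Definition rigid_motion {R : realType} (Q : 'M[R]_3) (b x : 'cV[R]_3) :
  'cV[R]_3 := Q *m x + b.

Definition smooth {R : realType} (f : R -> 'cV[R]_3) : Prop :=
  forall (n : nat) (t : R), derivable (derive1n n f) t 1.

Definition immersion {R : realType} (gamma : R -> 'cV[R]_3) : Prop :=
  forall t : R, derive1 gamma t != 0.

(* gamma \in M_g, for g = (Q, b) and tau t = t + T0 *)
Definition monodromy_curve {R : realType} (T0 : R) (Q : 'M[R]_3)
    (b : 'cV[R]_3) (gamma : R -> 'cV[R]_3) : Prop :=
  [/\ smooth gamma, immersion gamma &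
      forall t : R, gamma (t + T0) = rigid_motion Q b (gamma t)].

(* The tangent space of M_g is the same at every curve. *)
Definition tangent_variation {R : realType} (T0 : R) (Q : 'M[R]_3)
    (X : R -> 'cV[R]_3) : Prop :=
  smooth X /\ forall t : R, X (t + T0) = Q *m X t.

Definition speed {R : realType} (gamma : R -> 'cV[R]_3) (t : R) : R :=
  enorm (derive1 gamma t).

Definition arclength_parametrized {R : realType} (gamma : R -> 'cV[R]_3) :
  Prop := forall t : R, speed gamma t = 1.

Definition arc_deriv {R : realType} (gamma : R -> 'cV[R]_3) (t : R) :
  'cV[R]_3 := (speed gamma t)^-1 *: derive1 gamma t.

(* Integral of f over [t0, t0 + T0] against ds = |d gamma/dt| dt. *)
Definition int_ds {R : realType} (T0 t0 : R) (gamma : R -> 'cV[R]_3)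
    (f : R -> R) : R :=
  \int[@lebesgue_measure R]_(t in `[t0, t0 + T0]) (f t * speed gamma t).

Definition vint_ds {R : realType} (T0 t0 : R) (gamma : R -> 'cV[R]_3)
    (f : R -> 'cV[R]_3) : 'cV[R]_3 :=
  \col_i int_ds T0 t0 gamma (fun t => f t i 0).

Definition curve_length {R : realType} (T0 t0 : R)
    (gamma : R -> 'cV[R]_3) : R :=
  int_ds T0 t0 gamma (fun=> 1).

Definition area_vector {R : realType} (T0 t0 : R) (b : 'cV[R]_3)
    (gamma : R -> 'cV[R]_3) : 'cV[R]_3 :=
  2^-1 *: vint_ds T0 t0 gamma (fun t => cross (gamma t) (arc_deriv gamma t))
  - 2^-1 *: cross b (gamma t0).

Definition volume_vector {R : realType} (T0 t0 : R) (b : 'cV[R]_3)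
    (gamma : R -> 'cV[R]_3) : 'cV[R]_3 :=
  3^-1 *: vint_ds T0 t0 gamma
    (fun t => cross (gamma t) (cross (gamma t) (arc_deriv gamma t)))
  - 6^-1 *: cross (gamma t0) (cross b (gamma t0)).

(* dF_gamma(X).  If gamma lies in M_g and X is tangent, then gamma + e X has
   monodromy g for every e, and is an immersion for small e. *)
Definition differential {R : realType} (F : (R -> 'cV[R]_3) -> R)
    (gamma X : R -> 'cV[R]_3) : R :=
  derive1 (fun e : R => F (fun t => gamma t + e *: X t)) 0.

Definition critical_at_fixed {R : realType} (T0 : R) (Q : 'M[R]_3)
    (L : (R -> 'cV[R]_3) -> R) (Fs : set ((R -> 'cV[R]_3) -> R))
    (gamma : R -> 'cV[R]_3) : Prop :=
  forall X : R -> 'cV[R]_3, tangent_variation T0 Q X ->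
    (forall F, Fs F -> differential F gamma X = 0) ->
    differential L gamma X = 0.

(* s is s_g; for g = id there is no screw direction and s is unconstrained. *)
Definition screw_direction {R : realType} (Q : 'M[R]_3) (b s : 'cV[R]_3) :
  Prop :=
  if Q != 1%:M then enorm s = 1 /\ Q *m s = s
  else b != 0 -> s = (enorm b)^-1 *: b.

Definition well_defined_components {R : realType} (T0 t0 : R) (Q : 'M[R]_3)
    (b s : 'cV[R]_3) : set ((R -> 'cV[R]_3) -> R) :=
  let A := area_vector T0 t0 b in
  let V := volume_vector T0 t0 b in
  let entries (W : (R -> 'cV[R]_3) -> 'cV[R]_3) :=
    [set F | exists i : 'I_3, F = fun gamma => W gamma i 0] in
  let along_s (W : (R -> 'cV[R]_3) -> 'cV[R]_3) :=
    [set fun gamma => dot s (W gamma)] in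
  if Q != 1%:M then along_s A `|` along_s V
  else if b != 0 then entries A `|` along_s V
  else entries A `|` entries V.

(* The Euler-Lagrange equation of the bending energy at fixed length and
   total torsion, for gamma parametrized by arc length: there the derivative
   in t is the arc-length derivative. *)
Definition elastic {R : realType} (gamma : R -> 'cV[R]_3) : Prop :=
  exists lambda1 lambda2 : R, forall t : R,
    derive1n 4 gamma t
    + (3 / 2 * dot (derive1n 2 gamma t) (derive1n 2 gamma t)) *: derive1n 2 gamma t
    - dot (derive1n 4 gamma t) (derive1 gamma t) *: derive1 gamma t
    - lambda1 *: derive1n 2 gamma t
    - lambda2 *: cross (derive1 gamma t) (derive1n 3 gamma t) = 0.

(* Main.v *)
Require Import Defs.
From mathcomp Require Import all_boot all_order all_algebra.
From mathcomp Require Import all_classical all_reals all_analysis.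
From mathcomp Require Import ring lra.
Import Order.TTheory GRing.Theory Num.Theory.
Import numFieldNormedType.Exports.

Set Implicit Arguments.
Unset Strict Implicit.
Unset Printing Implicit Defensive.

Local Open Scope classical_set_scope.
Local Open Scope ring_scope.

(** An arc-length parametrized curve is elastic exactly when it is the
    trajectory of a charge in a magnetic field [W] that is a Killing field,
      [gamma'' = gamma' x W], with [W(y) = a + v x y].
    Indeed the elastic equation is the derivative of
      [gamma''' + 3/2 |gamma''|^2 gamma' - l1 gamma' - l2 gamma' x gamma''],
    the force, which is thus a constant [v]; the torque
      [- (gamma' x gamma'' + l2 gamma' + v x gamma)]
    is then a constant [a] ([elastic_conserved]), and its cross product with
    [gamma'] is the equation of motion ([conserved_trajectory]). Conversely the
    equation of motion conserves [<gamma', W>] and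
    [|gamma''|^2 / 2 - <v, gamma'>], which provide the two multipliers of the
    elastic equation ([trajectory_elastic]). Comparing the conserved vectors at
    [t] and [t + T0] shows that [W] is invariant under the monodromy
    ([conserved_invariant]).

    On the variational side, integration by parts gives
      [dL(X) = - int <X, gamma''>],  [d<a, A>(X) = int <X, gamma' x a>],
      [d<v, V>(X) = int <X, gamma' x (v x gamma)>],
    the last two when [Q a = a], respectively [Q v = v] and [v x b = 0]: these
    are the conditions under which [W] is invariant, and in each of the three
    cases of the theorem the listed components correspond to generators of the
    space of invariant fields ([well_defined_componentsP], [generators_span]).
    So on the trajectory of an invariant field [dL] is a combination of the
    differentials of the components. In the other direction, Lagrange
    multipliers ([lagrange_multipliers]) yield an invariant [W] such that
    [gamma'' - gamma' x W] is orthogonal to all tangent variations;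
    being one of them, it vanishes ([stationary_trajectory]).

    Functionals are differentiated through second-order bounds on their
    integrands that are uniform along a fundamental domain
    ([is_derive_integral]). *)

(** * Vector algebra in coordinates *)

Section Coordinates.
Context {R : realType}.
Implicit Types (u v w x a : 'cV[R]_3) (Q : 'M[R]_3).

Lemma dotE u v : dot u v = u 0 0 * v 0 0 + u 1 0 * v 1 0 + u 2 0 * v 2 0.
Proof.
rewrite /dot !big_ord_recl big_ord0 addr0 !addrA.
by congr (_ * _ + _ * _ + _ * _); congr (_ _ _); apply/val_inj.
Qed.

Lemma cross0E u v : cross u v 0 0 = u 1 0 * v 2 0 - u 2 0 * v 1 0.
Proof. by rewrite mxE !add0r. Qed.

Lemma cross1E u v : cross u v 1 0 = u 2 0 * v 0 0 - u 0 0 * v 2 0.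
Proof.
by rewrite mxE; congr (_ * _ - _ * _); congr (_ _ _); apply/val_inj.
Qed.

Lemma cross2E u v : cross u v 2 0 = u 0 0 * v 1 0 - u 1 0 * v 0 0.
Proof.
by rewrite mxE; congr (_ * _ - _ * _); congr (_ _ _); apply/val_inj.
Qed.

Lemma vec3P u v :
  u 0 0 = v 0 0 -> u 1 0 = v 1 0 -> u 2 0 = v 2 0 -> u = v.
Proof.
move=> e0 e1 e2; apply/colP => -[[|[|[|//]]] ?].
- by rewrite (_ : Ordinal _ = 0) //; apply/val_inj.
- by rewrite (_ : Ordinal _ = 1) //; apply/val_inj.
- by rewrite (_ : Ordinal _ = 2) //; apply/val_inj.
Qed.

Lemma mulmx3E Q u i :
  (Q *m u) i 0 = Q i 0 * u 0 0 + Q i 1 * u 1 0 + Q i 2 * u 2 0.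
Proof.
rewrite mxE !big_ord_recl big_ord0 addr0 !addrA.
by congr (_ * _ + _ * _ + _ * _); congr (_ _ _); apply/val_inj.
Qed.

Lemma det3E Q : \det Q =
  Q 0 0 * (Q 1 1 * Q 2 2 - Q 1 2 * Q 2 1)
  - Q 0 1 * (Q 1 0 * Q 2 2 - Q 1 2 * Q 2 0)
  + Q 0 2 * (Q 1 0 * Q 2 1 - Q 1 1 * Q 2 0).
Proof.
(* Entries are indexed by the values of ordinals, which compute. *)
pose f (i j : nat) : R := Q (inord i) (inord j).
have fE i j : Q i j = f i j by rewrite /f !inord_val.
rewrite (expand_det_row _ 0) !big_ord_recl big_ord0 /cofactor.
rewrite !(expand_det_row _ (0 : 'I_2)) !big_ord_recl !big_ord0 /cofactor.
rewrite !det_mx11 !mxE !fE /= /bump /=.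
ring.
Qed.

End Coordinates.

(** Polynomial identities between vectors or scalars, checked on coordinates. *)
Ltac vec_coordinates :=
  first [apply: vec3P | idtac];
  rewrite ?(dotE, cross0E, cross1E, cross2E, mulmx3E, mxE).
Ltac vec_ring := vec_coordinates; ring.
Ltac vec_field := by vec_coordinates; field.

Section VectorAlgebra.
Context {R : realType}.
Implicit Types (u v w x a : 'cV[R]_3) (Q : 'M[R]_3) (k : R).

Lemma crossvv u : cross u u = 0.
Proof. vec_ring. Qed.

Lemma double_cross u v w : cross u (cross v w) = dot u w *: v - dot u v *: w.
Proof. vec_ring. Qed.

Lemma dotvv_ge0 u : 0 <= dot u u.
Proof. by rewrite dotE !addr_ge0 // -expr2 sqr_ge0. Qed.

Lemma dotvv_eq0 u : dot u u = 0 -> u = 0.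
Proof.
rewrite dotE => /eqP; rewrite -!expr2 !paddr_eq0 ?addr_ge0 ?sqr_ge0 //.
rewrite !sqrf_eq0 => /andP[/andP[/eqP u0 /eqP u1] /eqP u2].
by apply: vec3P; rewrite ?u0 ?u1 ?u2 !mxE.
Qed.

Lemma enorm_eq0 u : enorm u = 0 -> u = 0.
Proof.
by move/eqP; rewrite sqrtr_eq0 => u0; apply/dotvv_eq0/le_anti; rewrite u0 dotvv_ge0.
Qed.

Lemma sqr_enorm u : enorm u ^+ 2 = dot u u.
Proof. by rewrite sqr_sqrtr ?dotvv_ge0. Qed.

Lemma dot_SO3 Q u v : SO3 Q -> dot (Q *m u) (Q *m v) = dot u v.
Proof.
have dotM x y : dot x y = (x^T *m y) 0 0.
  by rewrite /dot mxE; apply: eq_bigr => i _; rewrite mxE.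
case=> QQT _; rewrite !dotM trmx_mul -mulmxA (mulmxA Q^T).
by rewrite (mulmx1C QQT) mul1mx.
Qed.

(** Both sides pair with [Q *m w] to the determinant of [w], [u], [v]. *)
Lemma cross_SO3 Q u v : SO3 Q -> cross (Q *m u) (Q *m v) = Q *m cross u v.
Proof.
move=> SQ; have [QQT detQ] := SQ.
pose d := cross (Q *m u) (Q *m v) - Q *m cross u v.
suff d0 : forall w, dot (Q *m w) d = 0.
  apply/eqP; rewrite -subr_eq0; apply/eqP/dotvv_eq0.
  by have := d0 (Q^T *m d); rewrite mulmxA QQT mul1mx.
move=> w; rewrite /d.
have -> : dot (Q *m w) (cross (Q *m u) (Q *m v) - Q *m cross u v) =
   dot (Q *m w) (cross (Q *m u) (Q *m v)) - dot (Q *m w) (Q *m cross u v).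
  move: (Q *m w) (cross _ _) (Q *m _) => x y z; vec_ring.
rewrite dot_SO3 //.
have -> : dot (Q *m w) (cross (Q *m u) (Q *m v)) = \det Q * dot w (cross u v).
  rewrite det3E; vec_ring.
by rewrite detQ mul1r subrr.
Qed.

(** If [n := s x a] were nonzero, the three independent vectors [s], [a], [n]
    would all be fixed: every [x] satisfies
    [<n,n> x = <x,n> n + <x,a> (n x s) - <x,s> (n x a)], and so [Q = 1]. *)
Lemma fixed_vectors_parallel Q s a : SO3 Q -> Q != 1%:M ->
  Q *m s = s -> Q *m a = a -> cross s a = 0.
Proof.
move=> SQ Q1 Qs Qa; apply/dotvv_eq0; set n := cross s a.
apply/eqP; apply: contraT => nn0; case/eqP: Q1.
have Qn : Q *m n = n by rewrite -cross_SO3 // Qs Qa.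
have fix_all x : Q *m x = x.
  apply: (scalerI nn0).
  rewrite scalemxAr.
  have -> : dot n n *: x =
      dot x n *: n + dot x a *: cross n s - dot x s *: cross n a.
    rewrite /n; vec_ring.
  rewrite mulmxBr mulmxDr -!scalemxAr.
  by rewrite -(cross_SO3 n s SQ) -(cross_SO3 n a SQ) Qn Qs Qa.
apply/matrixP => i j.
by have /colP/(_ i) := fix_all (delta_mx j 0); rewrite -colE !mxE eqxx andbT.
Qed.

End VectorAlgebra.

(** * Calculus of curves in space *)

Section VectorCalculus.
Context {R : realType}.
Implicit Types (f g : R -> 'cV[R]_3) (Q : 'M[R]_3) (k : R) (c : 'cV[R]_3).

(** Coordinatewise differentiation: the product rules reduce to those of real
    functions, and [vderiveP] recovers [derive1]. *)
Definition vderive f f' :=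
  forall (i : 'I_3) (t : R), is_derive t 1 (fun x => f x i 0) (f' t i 0).

Definition vcontinuous f := forall i : 'I_3, continuous (fun x => f x i 0).

Lemma is_derive_continuous (h h' : R -> R) :
  (forall t : R, is_derive t 1 h (h' t)) -> continuous h.
Proof.
by move=> dh t; apply/differentiable_continuous/derivable1_diffP; case: (dh t).
Qed.

Lemma vderive_continuous f f' : vderive f f' -> vcontinuous f.
Proof. by move=> df i; apply: is_derive_continuous (df i). Qed.

Lemma derivable_vderive f :
  (forall t, derivable f t 1) -> vderive f (derive1 f).
Proof.
move=> df i t; have /derivable_mxP/(_ i 0) dfi := df t.
apply: is_derive_eq (derivableP dfi) _.
by rewrite derive1E derive_mx // mxE.
Qed.

Lemma vderiveP f f' :
  vderive f f' -> (forall t, derivable f t 1) /\ derive1 f = f'.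
Proof.
move=> df; have df1 t : derivable f t 1.
  by apply/derivable_mxP => i j; rewrite (ord1 j); case: (df i t).
split=> //; apply/funext => t; apply/colP => i.
by rewrite derive1E derive_mx // mxE; case: (df i t).
Qed.

Lemma vderive_uniq f f' f'' : vderive f f' -> vderive f f'' -> f' = f''.
Proof. by move=> /vderiveP[_ <-] /vderiveP[_ <-]. Qed.

Lemma eq_vderive f f' f'' : vderive f f' -> (forall t, f' t = f'' t) -> vderive f f''.
Proof. by move=> df /funext <-. Qed.

Lemma vderive_cst c : vderive (fun=> c) (fun=> 0).
Proof. by move=> i t; rewrite mxE; apply: is_derive_cst. Qed.

Lemma vderiveD f f' g g' : vderive f f' -> vderive g g' ->
  vderive (fun t => f t + g t) (fun t => f' t + g' t).
Proof.
move=> df dg i t; rewrite mxE.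
rewrite [X in is_derive _ _ X](_ : _ = (fun x => f x i 0) + (fun x => g x i 0)).
  exact: is_deriveD.
by apply/funext => x; rewrite mxE.
Qed.

Lemma vderiveN f f' : vderive f f' -> vderive (fun t => - f t) (fun t => - f' t).
Proof.
move=> df i t; rewrite mxE.
rewrite [X in is_derive _ _ X](_ : _ = - (fun x => f x i 0)).
  exact: is_deriveN.
by apply/funext => x; rewrite mxE.
Qed.

Lemma vderiveB f f' g g' : vderive f f' -> vderive g g' ->
  vderive (fun t => f t - g t) (fun t => f' t - g' t).
Proof. by move=> df dg; apply: vderiveD => //; apply: vderiveN. Qed.

Lemma vderive_scale (h h' : R -> R) f f' :
  (forall t : R, is_derive t 1 h (h' t)) -> vderive f f' ->
  vderive (fun t => h t *: f t) (fun t => h t *: f' t + h' t *: f t).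
Proof.
move=> dh df i t.
rewrite [X in is_derive _ _ X](_ : _ = h * (fun x => f x i 0)); last first.
  by apply/funext => x; rewrite mxE.
have [d1 d2] := (dh t, df i t).
by apply: is_derive_eq; rewrite !mxE; congr (_ + _); exact: mulrC.
Qed.

Lemma vderiveZ k f f' : vderive f f' ->
  vderive (fun t => k *: f t) (fun t => k *: f' t).
Proof.
move=> df; have dk t := is_derive_cst k (t : R) 1.
by apply: eq_vderive (vderive_scale dk df) _ => t /=; rewrite scale0r addr0.
Qed.

Lemma vderive_cross f f' g g' : vderive f f' -> vderive g g' ->
  vderive (fun t => cross (f t) (g t))
          (fun t => cross (f' t) (g t) + cross (f t) (g' t)).
Proof.
move=> df dg i t.
rewrite [X in is_derive _ _ X](_ : _ =
    (fun x => f x (i + 1) 0) * (fun x => g x (i + 2) 0)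
    - (fun x => f x (i + 2) 0) * (fun x => g x (i + 1) 0)); last first.
  by apply/funext => x; rewrite mxE.
have := (df (i + 1), df (i + 2), dg (i + 1), dg (i + 2)).
move=> [[[d1 d2] d3] d4].
apply: is_derive_eq; rewrite !mxE /GRing.scale /=; ring.
Qed.

Lemma is_derive_dot f f' g g' : vderive f f' -> vderive g g' ->
  forall t : R, is_derive t 1 (fun t => dot (f t) (g t))
    (dot (f' t) (g t) + dot (f t) (g' t)).
Proof.
move=> df dg t.
rewrite [X in is_derive _ _ X](_ : _ =
    \sum_(i < 3) (fun x => f x i 0) * (fun x => g x i 0)); last first.
  by apply/funext => x; rewrite fct_sumE.
apply: is_derive_eq; first by apply: is_derive_sum => i; apply: is_deriveM.
rewrite /dot -big_split /=; apply: eq_bigr => i _.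
by rewrite addrC; congr (_ + _); exact: mulrC.
Qed.

Lemma vderive_mulmx Q f f' : vderive f f' ->
  vderive (fun t => Q *m f t) (fun t => Q *m f' t).
Proof.
move=> df i t.
rewrite [X in is_derive _ _ X](_ : _ =
    \sum_(j < 3) (Q i j \*: (fun x => f x j 0))); last first.
  by apply/funext => x; rewrite fct_sumE mxE.
apply: is_derive_eq; first by apply: is_derive_sum => j; apply: is_deriveZ.
by rewrite mxE.
Qed.

Lemma vderive_shift k f f' : vderive f f' ->
  vderive (fun t => f (t + k)) (fun t => f' (t + k)).
Proof.
move=> df i t; have d1 := df i (t + k).
rewrite [X in is_derive _ _ X](_ : _ = (fun x => f x i 0) \o shift k) //.
have d2 := is_derive_shift t 1 k.
by apply: is_derive_eq; exact: mulr1.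
Qed.

Lemma vderive0_cst f : vderive f (fun=> 0) -> forall s t, f s = f t.
Proof.
move=> df s t; apply/colP => i; apply: (@is_derive_0_is_cst _ (fun x => f x i 0)).
by move=> x; have := df i x; rewrite mxE.
Qed.

Lemma smooth_vderive f : smooth f -> vderive f (derive1 f).
Proof. by move=> sf; apply: derivable_vderive; exact: sf 0%N. Qed.

Lemma smooth_derive1 f : smooth f -> smooth (derive1 f).
Proof. by move=> sf n t; rewrite -derive1Sn; exact: sf. Qed.

(** Smoothness up to a finite order, the form in which the Leibniz rule allows
    an induction. *)
Definition smooth_upto n f :=
  forall m, (m <= n)%N -> forall t, derivable (derive1n m f) t 1.

Lemma smooth_uptoS n f :
  smooth_upto n.+1 f <->
  (forall t, derivable f t 1) /\ smooth_upto n (derive1 f).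
Proof.
split=> [sf|[df sf] [|m] mn]; first 1 last.
- exact: df.
- by rewrite derive1Sn; exact: sf.
split; first exact: (sf 0%N).
by move=> m mn; rewrite -derive1Sn; exact: sf.
Qed.

Lemma smooth_upto_vderive n f : smooth_upto n f -> vderive f (derive1 f).
Proof. by move=> sf; apply: derivable_vderive; exact: sf 0%N _. Qed.

Lemma smooth_uptoW n f : smooth_upto n.+1 f -> smooth_upto n f.
Proof. by move=> sf m mn; apply: sf; exact: leqW. Qed.

Lemma smooth_uptoD n f g : smooth_upto n f -> smooth_upto n g ->
  smooth_upto n (fun t => f t + g t).
Proof.
elim: n f g => [|n IHn] f g sf sg.
  move=> [|//] _; apply: (vderiveP _).1.
  exact: vderiveD (smooth_upto_vderive sf) (smooth_upto_vderive sg).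
have [d dE] :=
  vderiveP (vderiveD (smooth_upto_vderive sf) (smooth_upto_vderive sg)).
apply/smooth_uptoS; split=> //; rewrite dE.
by apply: IHn; [case/smooth_uptoS: sf|case/smooth_uptoS: sg].
Qed.

Lemma smooth_upto_cross n f g : smooth_upto n f -> smooth_upto n g ->
  smooth_upto n (fun t => cross (f t) (g t)).
Proof.
elim: n f g => [|n IHn] f g sf sg.
  move=> [|//] _; apply: (vderiveP _).1.
  exact: vderive_cross (smooth_upto_vderive sf) (smooth_upto_vderive sg).
have [d dE] :=
  vderiveP (vderive_cross (smooth_upto_vderive sf) (smooth_upto_vderive sg)).
apply/smooth_uptoS; split=> //; rewrite dE; apply: smooth_uptoD; apply: IHn.
- by case/smooth_uptoS: sf.
- exact: smooth_uptoW.
- exact: smooth_uptoW.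
- by case/smooth_uptoS: sg.
Qed.

Lemma smoothD f g : smooth f -> smooth g -> smooth (fun t => f t + g t).
Proof.
by move=> sf sg n; apply: (@smooth_uptoD n).
Qed.

Lemma smooth_cross f g : smooth f -> smooth g ->
  smooth (fun t => cross (f t) (g t)).
Proof.
by move=> sf sg n; apply: (@smooth_upto_cross n).
Qed.

Lemma smooth_cst c : smooth (fun=> c).
Proof.
move=> n; have [k ->] : exists k : 'cV[R]_3,
    derive1n n (fun=> c) = (fun=> k) :> (R -> _).
  elim: n => [|n [k IHn]]; first by exists c.
  by exists 0; rewrite derive1nS IHn; case: (vderiveP (vderive_cst k)).
by move=> t; case: (vderiveP (vderive_cst k)).
Qed.

Lemma smoothZ k f : smooth f -> smooth (fun t => k *: f t).
Proof.
move=> sf n t; suff [d _] : (forall t, derivable (derive1n n (fun t => k *: f t)) t 1) /\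
   derive1n n (fun t => k *: f t) = fun t => k *: derive1n n f t by [].
elim: n => [|n [_ IHn]].
  by split=> //; case: (vderiveP (vderiveZ k (smooth_vderive sf))).
have sfn m : vderive (derive1n m f) (derive1n m.+1 f).
  by apply: derivable_vderive; exact: sf.
rewrite derive1nS IHn (vderiveP (vderiveZ k (sfn n))).2; split=> //.
exact: (vderiveP (vderiveZ k (sfn n.+1))).1.
Qed.

Lemma vcontinuous_cst c : vcontinuous (fun=> c).
Proof. exact: vderive_continuous (vderive_cst c). Qed.

Lemma vcontinuous_cross f g : vcontinuous f -> vcontinuous g ->
  vcontinuous (fun t => cross (f t) (g t)).
Proof.
move=> cf cg i; under eq_fun do rewrite mxE.
by move=> t; apply: cvgB; apply: cvgM; [exact: cf|exact: cg|exact: cf|exact: cg].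
Qed.

Lemma vcontinuousD f g : vcontinuous f -> vcontinuous g ->
  vcontinuous (fun t => f t + g t).
Proof.
move=> cf cg i; under eq_fun do rewrite mxE.
by move=> t; apply: cvgD; [exact: cf|exact: cg].
Qed.

Lemma continuous_dot f g : vcontinuous f -> vcontinuous g ->
  continuous (fun t => dot (f t) (g t)).
Proof.
move=> cf cg; under eq_fun do rewrite dotE.
move=> t.
by apply: cvgD; [apply: cvgD|]; apply: cvgM; (exact: cf || exact: cg).
Qed.

End VectorCalculus.

(** * Integrals of continuous functions *)

Section Integration.
Context {R : realType}.
Variables (a b : R).
Hypothesis ab : a < b.
Implicit Types f g h p F : R -> R.

Local Notation I f := (\int[@lebesgue_measure R]_(t in `[a, b]) f t).

Lemma continuous_integrable f : continuous f ->
  (@lebesgue_measure R).-integrable `[a, b] (EFin \o f).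
Proof.
move=> cf; apply: continuous_compact_integrable; first exact: segment_compact.
exact: continuous_subspaceT.
Qed.

Lemma integral_continuousD f g : continuous f -> continuous g ->
  \int[@lebesgue_measure R]_(t in `[a, b]) (f t + g t) = I f + I g.
Proof. by move=> cf cg; apply: RintegralD => //; exact: continuous_integrable. Qed.

Lemma integral_continuousZ f k : continuous f ->
  \int[@lebesgue_measure R]_(t in `[a, b]) (k * f t) = k * I f.
Proof. by move=> cf; apply: RintegralZl => //; exact: continuous_integrable. Qed.

Lemma integral_is_derive f F : continuous f ->
  (forall t : R, is_derive t 1 F (f t)) -> I f = F b - F a.
Proof.
move=> cf dF; have cF := is_derive_continuous dF.
rewrite /Rintegral (continuous_FTC2 ab _ (F := F)) //.
- exact: continuous_subspaceT.
- split=> [t _||]; first by case: (dF t).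
  + exact/cvg_at_right_filter/cF.
  + exact/cvg_at_left_filter/cF.
- by move=> t _; rewrite derive1E; case: (dF t).
Qed.

(** The primitive of [f] is monotone between equal values, hence constant,
    and its derivative is [f]. *)
Lemma integral_eq0_continuous f : continuous f -> (forall t, 0 <= f t) ->
  I f = 0 -> forall t, a <= t < b -> f t = 0.
Proof.
move=> cf f0 If0.
have intf := continuous_integrable cf.
pose P x := \int[@lebesgue_measure R]_(t in `[a, x]) f t.
have P0 x : a <= x <= b -> P x = 0.
  move=> /andP[ax xb]; apply/le_anti; rewrite Rintegral_ge0 // andbT.
  rewrite -If0 -subr_ge0 Rintegral_itvB ?bnd_simp //.
  exact: Rintegral_ge0.
have fin t : a < t < b -> f t = 0.
  move=> /andP[at_ tb].
  have [_ <-] := continuous_FTC1_closed tb intf at_ (cf t).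
  rewrite derive1E; have [_ //] : is_derive t 1 P 0.
  have d0 : is_derive t 1 (cst (0 : R)) 0 by exact: is_derive_cst.
  apply: near_eq_is_derive d0; near=> x.
  rewrite P0 //; apply/andP; split; apply: ltW; near: x.
  - exact: lt_nbhsr.
  - exact: lt_nbhsl.
move=> t /andP[]; rewrite le_eqVlt => /predU1P[<- _|at_ tb]; last first.
  by apply: fin; rewrite at_.
apply/eqP; apply: contraT => fa0.
have fa : 0 < f a by rewrite lt0r fa0 f0.
near a^'+ => x; suff : 0 < f x by rewrite fin ?ltxx //; apply/andP; split.
near: x; apply: (cvgr_gt (f a)) => //.
exact/cvg_at_right_filter/cf.
Unshelve. all: by end_near. Qed.

Lemma quadratic_is_derive (f : R -> R) c C :
  (forall e, `|e| <= 1 -> `|f e - f 0 - e * c| <= C * e ^+ 2) ->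
  is_derive (0 : R) 1 f c.
Proof.
move=> fC.
have cv : h^-1 *: ((f \o shift 0) (h *: 1) - f 0) @[h --> 0^'] --> c.
  apply/cvgrPdist_le => eps eps0; near=> h.
  have h0 : h != 0 by near: h; exact: nbhs_dnbhs_neq.
  have nh0 : 0 < `|h| by rewrite normr_gt0.
  have h1 : `|h| <= 1 by near: h; apply: dnbhs0_le.
  have hC : `|h| <= eps / (`|C| + 1).
    by near: h; apply: dnbhs0_le; rewrite divr_gt0 // ltr_wpDl.
  rewrite /= /shift /= addr0 [h *: 1]mulr1 distrC.
  have -> : h^-1 *: (f h - f 0) - c = h^-1 * (f h - f 0 - h * c).
    by rewrite mulrBr mulKf.
  rewrite normrM normfV ler_pdivrMl //.
  apply: le_trans (fC _ h1) _; rewrite -real_normK ?num_real // expr2 mulrCA.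
  rewrite ler_pM2l //; apply: le_trans (_ : (`|C| + 1) * `|h| <= _).
    by rewrite ler_wpM2r // (le_trans (ler_norm _)) // lerDl.
  by rewrite mulrC -ler_pdivlMr // ltr_wpDl.
by apply: DeriveDef; [apply/cvg_ex; exists c|apply/cvg_lim].
Unshelve. all: by end_near. Qed.

Lemma continuous_bounded f : continuous f ->
  exists2 M, 0 <= M & forall t, t \in `[a, b] -> `|f t| <= M.
Proof.
move=> cf; have cnf : continuous (fun t => `|f t|).
  by move=> t; apply: cvg_norm; exact: cf.
have [c _ fc] := EVT_max (ltW ab) (continuous_subspaceT cnf).
by exists `|f c|.
Qed.

(** Differentiation under the integral sign: a second-order remainder that is
    uniform in [t] stays of second order after integration. *)
Lemma is_derive_integral (h : R -> R -> R) p C :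
  (forall e, continuous (h e)) -> continuous p ->
  (forall e t, `|e| <= 1 -> t \in `[a, b] ->
    `|h e t - h 0 t - e * p t| <= C * e ^+ 2) ->
  is_derive (0 : R) 1
    (fun e => \int[@lebesgue_measure R]_(t in `[a, b]) h e t) (I p).
Proof.
move=> ch cp hC; apply: (@quadratic_is_derive _ _ (C * (b - a))) => e e1.
pose r t := h e t - h 0 t - e * p t.
have cr : continuous r.
  move=> t; apply: cvgB; first by apply: cvgB; exact: ch.
  by apply: cvgMr; exact: cp.
have -> : I (h e) - I (h 0) - e * I p = I r.
  rewrite -integral_continuousZ // -RintegralB //; try exact: continuous_integrable.
  rewrite -RintegralB //; apply: continuous_integrable => t.
    by apply: cvgB; exact: ch.
  by apply: cvgMr; exact: cp.
apply: le_trans (le_normr_Rintegral _ _) _ => //; first exact: continuous_integrable.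
have -> : C * (b - a) * e ^+ 2 = \int[@lebesgue_measure R]_(t in `[a, b]) (C * e ^+ 2).
  have mab : lebesgue_measure `[a, b] = (b - a)%:E.
    by rewrite lebesgue_measure_itv /= lte_fin ab.
  rewrite Rintegral_cst //.
  by rewrite [fine _](congr1 fine mab) /= mulrAC.
apply: le_Rintegral => //.
- by apply: continuous_integrable => t; apply: cvg_norm; exact: cr.
- by apply: continuous_integrable => t; exact: cvg_cst.
- by move=> t tab; exact: hC.
Qed.

End Integration.

(** * Elastic curves as trajectories in a Killing field *)

Section KillingField.
Context {R : realType}.
Implicit Types (f g : R -> 'cV[R]_3) (a v : 'cV[R]_3).

(** The velocity field of the infinitesimal motion with translation part [a]
    and rotation part [v]. *)
Definition killing (a v x : 'cV[R]_3) : 'cV[R]_3 := a + cross v x.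

Lemma is_derive_cst_eq0 (h h' : R -> R) k :
  (forall t : R, is_derive t 1 h (h' t)) -> (forall t, h t = k) ->
  forall t, h' t = 0.
Proof.
move=> dh hk t; case: (dh t) => _ <-.
have -> : h = cst k by apply/funext.
by rewrite derive_cst.
Qed.

Lemma is_derive0_cst (h h' : R -> R) :
  (forall t : R, is_derive t 1 h (h' t)) -> (forall t, h' t = 0) ->
  forall t, h t = h 0.
Proof.
by move=> dh h'0 t; apply: is_derive_0_is_cst => x; rewrite -(h'0 x); exact: dh.
Qed.

(** All that follows uses of the curve [g0] is that its unit tangent [g1] can be
    differentiated three times. *)
Variables g0 g1 g2 g3 g4 : R -> 'cV[R]_3.
Hypotheses (d0 : vderive g0 g1) (d1 : vderive g1 g2) (d2 : vderive g2 g3)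
  (d3 : vderive g3 g4).
Hypothesis tangent_unit : forall t, dot (g1 t) (g1 t) = 1.

Lemma tangent_normal t : dot (g1 t) (g2 t) = 0.
Proof.
have /(_ t) := is_derive_cst_eq0 (is_derive_dot d1 d1) tangent_unit.
have -> : dot (g2 t) (g1 t) = dot (g1 t) (g2 t) by vec_ring.
lra.
Qed.

Lemma dot_d1_d3 t : dot (g1 t) (g3 t) = - dot (g2 t) (g2 t).
Proof.
have /(_ t) := is_derive_cst_eq0 (is_derive_dot d1 d2) tangent_normal.
lra.
Qed.

Lemma dot_d1_d4 t : dot (g4 t) (g1 t) = - 3 * dot (g2 t) (g3 t).
Proof.
have dh x := is_deriveD (is_derive_dot d1 d3 x) (is_derive_dot d2 d2 x).
have h0 x : dot (g1 x) (g3 x) + dot (g2 x) (g2 x) = 0.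
  by rewrite dot_d1_d3 addNr.
have /(_ t) := is_derive_cst_eq0 dh h0.
have -> : dot (g3 t) (g2 t) = dot (g2 t) (g3 t) by vec_ring.
have -> : dot (g4 t) (g1 t) = dot (g1 t) (g4 t) by vec_ring.
lra.
Qed.

(** Newton's equation of a charge moving in the magnetic field [killing a v]. *)
Definition killing_trajectory a v : Prop :=
  forall t, g2 t = cross (g1 t) (killing a v (g0 t)).

Let dkappa (x : R) : is_derive x 1 (fun t => 3 / 2 * dot (g2 t) (g2 t))
  (3 * dot (g2 x) (g3 x)).
Proof.
have dd := is_derive_dot d2 d2 x.
rewrite [X in is_derive _ _ X](_ : _ = (3 / 2) \*: (fun t => dot (g2 t) (g2 t))) //.
apply: is_derive_eq.
have -> : dot (g3 x) (g2 x) = dot (g2 x) (g3 x) by vec_ring.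
by rewrite /GRing.scale /=; lra.
Qed.

(** The conserved vectors of an elastic curve: [force] comes from invariance
    of the energy under translations, [torque] from rotations. *)
Definition force l1 l2 t : 'cV[R]_3 :=
  g3 t + (3 / 2 * dot (g2 t) (g2 t)) *: g1 t - l1 *: g1 t
  - l2 *: cross (g1 t) (g2 t).

Definition torque l2 v t : 'cV[R]_3 :=
  - (cross (g1 t) (g2 t) + l2 *: g1 t + cross v (g0 t)).

Definition elastic_lhs l1 l2 t : 'cV[R]_3 :=
  g4 t + (3 / 2 * dot (g2 t) (g2 t)) *: g2 t
  - dot (g4 t) (g1 t) *: g1 t - l1 *: g2 t - l2 *: cross (g1 t) (g3 t).

Let dforce l1 l2 : vderive (force l1 l2) (elastic_lhs l1 l2).
Proof.
have dN := vderiveB (vderiveB (vderiveD d3 (vderive_scale dkappa d1))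
  (vderiveZ l1 d1)) (vderiveZ l2 (vderive_cross d1 d2)).
apply: eq_vderive dN _ => t.
rewrite /elastic_lhs dot_d1_d4 crossvv add0r mulNr scaleNr opprK.
by rewrite !addrA.
Qed.

(** The derivative of the force is the elastic equation itself, and the
    derivative of the torque is [(force - v) x gamma']. *)
Lemma elastic_conserved l1 l2 : (forall t, elastic_lhs l1 l2 t = 0) ->
  exists a v, (forall t, force l1 l2 t = v) /\ (forall t, torque l2 v t = a).
Proof.
move=> ell; have dF : vderive (force l1 l2) (fun=> 0) := eq_vderive (dforce l1 l2) ell.
pose v := force l1 l2 0.
have Fv t : force l1 l2 t = v by exact: vderive0_cst dF t 0.
have dM : vderive (torque l2 v) (fun=> 0).
  have dM' := vderiveN (vderiveD (vderiveD (vderive_cross d1 d2) (vderiveZ l2 d1))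
    (vderive_cross (vderive_cst v) d0)).
  apply: eq_vderive dM' _ => t /=.
  have n11 := tangent_unit t; have n12 := tangent_normal t.
  rewrite -(Fv t) /force.
  set x1 := g1 t in n11 n12 *; set x2 := g2 t in n12 *.
  have -> : l2 *: x2 = l2 *: cross (cross x1 x2) x1.
    have -> : cross (cross x1 x2) x1 = dot x1 x1 *: x2 - dot x1 x2 *: x1 by vec_ring.
    by rewrite n11 n12 scale1r scale0r subr0.
  move: (g3 t) (dot x2 x2) (g0 t) => x3 k x0; vec_ring.
exists (torque l2 v 0), v; split=> // t.
exact: vderive0_cst dM t 0.
Qed.

(** Take the cross product of the constant torque with [gamma']. *)
Lemma conserved_trajectory l2 a v :
  (forall t, torque l2 v t = a) -> killing_trajectory a v.
Proof.
move=> Ma t; rewrite /killing -(Ma t) /torque.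
have n11 := tangent_unit t; have n12 := tangent_normal t.
have -> : cross (g1 t) (- (cross (g1 t) (g2 t) + l2 *: g1 t + cross v (g0 t))
    + cross v (g0 t)) = dot (g1 t) (g1 t) *: g2 t - dot (g1 t) (g2 t) *: g1 t.
  move: (g1 t) (g2 t) (g0 t) => x1 x2 x0; vec_ring.
by rewrite n11 n12 scale1r scale0r subr0.
Qed.

(** For the field [W], both [c = <gamma', W>] and
    [k = |gamma''|^2 / 2 - <v, gamma'>] are constant along the trajectory; with
    them the derivative of the equation of motion says that the force vector
    of parameters [k] and [- c] is [v]. *)
Lemma trajectory_elastic a v : killing_trajectory a v ->
  exists l1 l2, forall t, elastic_lhs l1 l2 t = 0.
Proof.
move=> tr.
have dW : vderive (fun t => killing a v (g0 t)) (fun t => cross v (g1 t)).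
  have dW' := vderiveD (vderive_cst a) (vderive_cross (vderive_cst v) d0).
  by apply: eq_vderive dW' _ => t; vec_ring.
have cP := is_derive0_cst (is_derive_dot d1 dW).
pose c := dot (g1 0) (killing a v (g0 0)).
have {}cP t : dot (g1 t) (killing a v (g0 t)) = c.
  by apply: cP => x; rewrite tr; vec_ring.
have g3E t : g3 t = cross (g2 t) (killing a v (g0 t))
    + cross (g1 t) (cross v (g1 t)).
  have d2' : vderive g2 (fun t => cross (g2 t) (killing a v (g0 t))
    + cross (g1 t) (cross v (g1 t))).
    by rewrite [in X in vderive X](funext tr); apply: vderive_cross.
  by rewrite (vderive_uniq d2 d2').
have n23 t : dot (g2 t) (g3 t) = dot v (g2 t).
  rewrite g3E.
  have -> : dot (g2 t) (cross (g2 t) (killing a v (g0 t))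
    + cross (g1 t) (cross v (g1 t))) =
    dot (g1 t) (g1 t) * dot v (g2 t) - dot (g1 t) v * dot (g1 t) (g2 t).
    move: (g1 t) (g2 t) (killing _ _ _) => x1 x2 w; vec_ring.
  by rewrite tangent_unit tangent_normal mul1r mulr0 subr0.
pose k := 2^-1 * dot (g2 0) (g2 0) - dot v (g1 0).
have kP t : 2^-1 * dot (g2 t) (g2 t) - dot v (g1 t) = k.
  have dk (x : R) : is_derive x 1 (fun t => 2^-1 * dot (g2 t) (g2 t) - dot v (g1 t)) 0.
    have dd := is_derive_dot d2 d2 x.
    have dv := is_derive_dot (vderive_cst v) d1 x.
    rewrite [X in is_derive _ _ X](_ : _ = 2^-1 \*: (fun t => dot (g2 t) (g2 t))
      - (fun t => dot v (g1 t))) //.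
    apply: is_derive_eq.
    have -> : dot (g3 x) (g2 x) = dot (g2 x) (g3 x) by vec_ring.
    have -> : dot 0 (g1 x) = 0 by vec_ring.
    by rewrite n23 /GRing.scale /=; lra.
  exact: (is_derive0_cst dk).
have Fv t : force k (- c) t = v.
  rewrite /force -(kP t) -(cP t) g3E.
  have n11 := tangent_unit t; have n12 := tangent_normal t.
  have n22 : dot (g2 t) (g2 t) = dot (killing a v (g0 t)) (killing a v (g0 t))
     - c ^+ 2.
    rewrite -(cP t) tr.
    have -> : dot (cross (g1 t) (killing a v (g0 t)))
      (cross (g1 t) (killing a v (g0 t))) = dot (g1 t) (g1 t) *
       dot (killing a v (g0 t)) (killing a v (g0 t)) -
       dot (g1 t) (killing a v (g0 t)) ^+ 2.
      move: (g1 t) (killing _ _ _) => x1 w; vec_ring.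
    by rewrite n11 mul1r.
  move: n22; rewrite -(cP t) => n22; rewrite n22 tr.
  move: (g1 t) (killing _ _ _) n11 => x1 w n11.
  (* The two sides differ by a multiple of [dot x1 x1 - 1]. *)
  transitivity (v + (dot x1 x1 - 1) *: (v - (dot x1 w) *: w)); last first.
    by rewrite n11 subrr scale0r addr0.
  vec_field.
exists k, (- c) => t.
have dF : vderive (fun=> v) (elastic_lhs k (- c)).
  by rewrite -(funext Fv); exact: dforce.
by rewrite (vderive_uniq dF (vderive_cst v)).
Qed.

End KillingField.

(** * First variation of length, area and volume *)

Section FirstVariation.
Context {R : realType}.
Variables (T0 t0 : R) (Q : 'M[R]_3) (b : 'cV[R]_3).
Hypotheses (T0_gt0 : 0 < T0) (SQ : SO3 Q) (Qb : Q *m b = b).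

Local Notation I f := (\int[@lebesgue_measure R]_(t in `[t0, t0 + T0]) f t).

Let dom : t0 < t0 + T0. Proof. by rewrite ltrDl. Qed.

(** The virtual work, under the displacement [Y], of the magnetic force that
    the field [killing a v] exerts on the moving point. *)
Definition work (c : R -> 'cV[R]_3) (a v : 'cV[R]_3) (Y : R -> 'cV[R]_3) : R :=
  \int[@lebesgue_measure R]_(t in `[t0, t0 + T0])
    dot (Y t) (cross (derive1 c t) (killing a v (c t))).

Lemma speed_arc_deriv (c : R -> 'cV[R]_3) t :
  speed c t *: arc_deriv c t = derive1 c t.
Proof.
rewrite /arc_deriv scalerA; have [s0|s0] := eqVneq (speed c t) 0.
  by rewrite s0 mul0r scale0r; apply/esym/enorm_eq0.
by rewrite divff // scale1r.
Qed.

(** The factor [ds / dt] cancels the normalization of the arc-length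
    derivative, so that the integrand is polynomial in the curve. *)
Lemma dot_vint_ds (a : 'cV[R]_3) (c f w : R -> 'cV[R]_3) :
  (forall t, speed c t *: f t = w t) -> vcontinuous w ->
  dot a (vint_ds T0 t0 c f) = I (fun t => dot a (w t)).
Proof.
move=> fw cw; rewrite dotE !mxE /int_ds.
have fwi i : \int[@lebesgue_measure R]_(t in `[t0, t0 + T0]) (f t i 0 * speed c t)
    = I (fun t => w t i 0).
  by apply: eq_Rintegral => t _; rewrite -fw mxE mulrC.
rewrite !fwi -!integral_continuousZ //; try exact: cw.
have ck i : continuous (fun t => a i 0 * w t i 0).
  by move=> t; apply: cvgMr; exact: cw.
rewrite -!integral_continuousD //; last by move=> t; apply: cvgD; exact: ck.
by apply: eq_Rintegral => t _; rewrite dotE.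
Qed.

Lemma monodromy_vderive (c c' : R -> 'cV[R]_3) k : vderive c c' ->
  (forall t, c (t + T0) = Q *m c t + k) ->
  forall t, c' (t + T0) = Q *m c' t.
Proof.
move=> dc cT t; have := vderive_shift T0 dc; rewrite (funext cT) => ds.
have := vderive_uniq ds (vderiveD (vderive_mulmx Q dc) (vderive_cst k)).
by move=> /(congr1 (@^~ t)) ->; rewrite addr0.
Qed.

Lemma area_component (a : 'cV[R]_3) (c c' : R -> 'cV[R]_3) :
  derive1 c = c' -> vcontinuous c -> vcontinuous c' ->
  dot a (area_vector T0 t0 b c) =
  2^-1 * I (fun t => dot a (cross (c t) (c' t))) - 2^-1 * dot a (cross b (c t0)).
Proof.
move=> cc' cc cc1; rewrite -(@dot_vint_ds a c (fun t => cross (c t) (arc_deriv c t))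
  (fun t => cross (c t) (c' t))) //.
- by rewrite /area_vector; move: (vint_ds _ _ _ _) (cross _ _) => x y; vec_ring.
- by move=> t; rewrite -cc' -speed_arc_deriv; vec_ring.
- exact: vcontinuous_cross.
Qed.

Lemma volume_component (v : 'cV[R]_3) (c c' : R -> 'cV[R]_3) :
  derive1 c = c' -> vcontinuous c -> vcontinuous c' ->
  dot v (volume_vector T0 t0 b c) =
  3^-1 * I (fun t => dot v (cross (c t) (cross (c t) (c' t))))
  - 6^-1 * dot v (cross (c t0) (cross b (c t0))).
Proof.
move=> cc' cc cc1.
rewrite -(@dot_vint_ds v c (fun t => cross (c t) (cross (c t) (arc_deriv c t)))
  (fun t => cross (c t) (cross (c t) (c' t)))) //.
- by rewrite /volume_vector; move: (vint_ds _ _ _ _) (cross _ _) => x y; vec_ring.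
- by move=> t; rewrite -cc' -speed_arc_deriv; vec_ring.
- exact/vcontinuous_cross/vcontinuous_cross.
Qed.

Variables gamma g1 g2 X X1 X2 : R -> 'cV[R]_3.
Hypotheses (d0 : vderive gamma g1) (d1 : vderive g1 g2) (cg2 : vcontinuous g2).
Hypotheses (dX : vderive X X1) (dX1 : vderive X1 X2).
Hypothesis gammaT : forall t, gamma (t + T0) = Q *m gamma t + b.
Hypothesis XT : forall t, X (t + T0) = Q *m X t.

Let cg := vderive_continuous d0.
Let cg1 := vderive_continuous d1.
Let cX := vderive_continuous dX.
Let cX1 := vderive_continuous dX1.

Let varE e : derive1 (fun t => gamma t + e *: X t) =
  (fun t => g1 t + e *: X1 t).
Proof. exact: (vderiveP (vderiveD d0 (vderiveZ e dX))).2. Qed.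

Let cvar e : vcontinuous (fun t => gamma t + e *: X t).
Proof. exact: vderive_continuous (vderiveD d0 (vderiveZ e dX)). Qed.

Let cvar1 e : vcontinuous (fun t => g1 t + e *: X1 t).
Proof. exact: vderive_continuous (vderiveD d1 (vderiveZ e dX1)). Qed.

Let continuous_dot_cst (a : 'cV[R]_3) (w : R -> 'cV[R]_3) :
  vcontinuous w -> continuous (fun t => dot a (w t)).
Proof. by move=> cw; apply: continuous_dot => //; exact: vcontinuous_cst. Qed.

Let continuous_work (a v : 'cV[R]_3) : continuous (fun t =>
  dot (X t) (cross (g1 t) (killing a v (gamma t)))).
Proof.
apply: continuous_dot cX _; apply: vcontinuous_cross cg1 _.
by apply: vcontinuousD; [|apply: vcontinuous_cross cg]; exact: vcontinuous_cst.
Qed.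

Lemma differentialE (F : (R -> 'cV[R]_3) -> R) d :
  is_derive (0 : R) 1 (fun e : R => F (fun t => gamma t + e *: X t)) d ->
  differential F gamma X = d.
Proof. by move=> dF; rewrite /differential derive1E; case: dF. Qed.

(** The variation of the integrand is [2 <X, gamma' x a>] plus the derivative
    of [<a, gamma x X>]. The boundary terms of the latter cancel against the
    correction term of [area_vector] exactly because [Q] fixes [a]. *)
Lemma differential_area (a : 'cV[R]_3) : Q *m a = a ->
  differential (fun c => dot a (area_vector T0 t0 b c)) gamma X = work gamma a 0 X.
Proof.
move=> Qa; apply: differentialE.
rewrite [X in is_derive _ _ X](_ : _ = (fun e => 2^-1 *
    I (fun t => dot a (cross (gamma t + e *: X t)
      (g1 t + e *: X1 t)))
    - 2^-1 * dot a (cross b (gamma t0 + e *: X t0)))); last first.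
  by apply/funext => e; apply: area_component (@varE e) (@cvar e) (@cvar1 e).
pose p t := dot a (cross (X t) (g1 t)) + dot a (cross (gamma t) (X1 t)).
have cc := @continuous_dot_cst a.
have cp : continuous p.
  by move=> t; apply: cvgD; apply: cc; exact: vcontinuous_cross.
have [M M0 hM] := continuous_bounded dom (cc _ (vcontinuous_cross cX cX1)).
have dI := @is_derive_integral _ _ _ dom (fun e t => dot a (cross
  (gamma t + e *: X t) (g1 t + e *: X1 t))) p M.
have {}dI := dI (fun e => cc _ (vcontinuous_cross (@cvar e) (@cvar1 e))) cp.
have {}dI : is_derive (0 : R) 1 (fun e => I (fun t => dot a (cross
  (gamma t + e *: X t) (g1 t + e *: X1 t)))) (I p).
  apply: dI => e t e1 tI.
  rewrite (_ : _ - _ = e ^+ 2 * dot a (cross (X t) (X1 t))); last first.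
    by rewrite /p; move: (gamma t) (X t) (g1 t) (X1 t) =>
      x0 y0 x1 y1; vec_ring.
  rewrite normrM ger0_norm ?sqr_ge0 // mulrC ler_wpM2r ?sqr_ge0 //.
  exact: hM.
have dB : is_derive (0 : R) 1 (fun e => dot a (cross b (gamma t0 + e *: X t0)))
    (dot a (cross b (X t0))).
  apply: (@quadratic_is_derive _ _ _ 0) => e _; rewrite mul0r.
  rewrite [X in `|X|](_ : _ = 0) ?normr0 //.
  by move: (gamma t0) (X t0) => x0 y0; vec_ring.
have -> : work gamma a 0 X = 2^-1 * I p - 2^-1 * dot a (cross b (X t0)).
  have dS (t : R) : is_derive t 1 (fun t => dot a (cross (gamma t) (X t)))
      (dot a (cross (g1 t) (X t) + cross (gamma t) (X1 t))).
    apply: is_derive_eq (is_derive_dot (vderive_cst a) (vderive_cross d0 dX) t) _.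
    by vec_ring.
  have cS : continuous (fun t =>
      dot a (cross (g1 t) (X t) + cross (gamma t) (X1 t))).
    by apply: cc; apply: vcontinuousD; exact: vcontinuous_cross.
  have := integral_is_derive dom cS dS; rewrite gammaT XT.
  have -> : dot a (cross (Q *m gamma t0 + b) (Q *m X t0)) =
      dot a (cross (gamma t0) (X t0)) + dot a (cross b (X t0)).
    transitivity (dot (Q *m a) (cross (Q *m gamma t0) (Q *m X t0)) +
      dot (Q *m a) (cross (Q *m b) (Q *m X t0))).
      rewrite Qa Qb; move: (Q *m _) (Q *m _) => x y; vec_ring.
    by rewrite !cross_SO3 // !dot_SO3.
  have -> : I p = I (fun t => dot a (cross (g1 t) (X t)
      + cross (gamma t) (X1 t))) + 2 * work gamma a 0 X.
    rewrite /work (vderiveP d0).2 -integral_continuousZ //.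
    rewrite -integral_continuousD //; last first.
      by move=> t; apply: cvgMr; exact: continuous_work.
    apply: eq_Rintegral => t _; rewrite /p /killing.
    by move: (gamma t) (X t) (g1 t) (X1 t) =>
      x0 y0 x1 y1; vec_ring.
  by move=> ->; field.
have dI2 := is_deriveZ 2^-1 dI.
have dB2 := is_deriveZ 2^-1 dB.
exact: is_deriveB dI2 dB2.
Qed.

(** The variation of the integrand is [3 <X, gamma' x (v x gamma)>] plus the
    derivative of [<v, gamma x (gamma x X)>]. By the Jacobi identity the
    boundary terms and the variation of the correction term leave a multiple
    of [<v x b, gamma x X>]. *)
Lemma differential_volume (v : 'cV[R]_3) : Q *m v = v -> cross v b = 0 ->
  differential (fun c => dot v (volume_vector T0 t0 b c)) gamma X = work gamma 0 v X.
Proof.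
move=> Qv vb; apply: differentialE.
pose h e t := dot v (cross (gamma t + e *: X t) (cross (gamma t + e *: X t)
  (g1 t + e *: X1 t))).
pose B e := dot v (cross (gamma t0 + e *: X t0) (cross b (gamma t0 + e *: X t0))).
rewrite [X in is_derive _ _ X](_ : _ = (fun e => 3^-1 * I (h e) - 6^-1 * B e));
  last first.
  by apply/funext => e; apply: volume_component (@varE e) (@cvar e) (@cvar1 e).
pose p t := dot v (cross (X t) (cross (gamma t) (g1 t)))
  + dot v (cross (gamma t) (cross (X t) (g1 t)))
  + dot v (cross (gamma t) (cross (gamma t) (X1 t))).
have cc := @continuous_dot_cst v.
have cp : continuous p.
  move=> t; apply: cvgD; [apply: cvgD|]; apply: cc;
    by apply: vcontinuous_cross => //; exact: vcontinuous_cross.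
have ch e : continuous (h e).
  apply: cc; apply: vcontinuous_cross; first exact: cvar.
  by apply: vcontinuous_cross; [exact: cvar|exact: cvar1].
pose r1 t := cross (gamma t) (cross (X t) (X1 t))
  + cross (X t) (cross (gamma t) (X1 t))
  + cross (X t) (cross (X t) (g1 t)).
have cr1 : vcontinuous r1.
  apply: vcontinuousD; [apply: vcontinuousD|];
    by apply: vcontinuous_cross => //; exact: vcontinuous_cross.
have [M1 _ hM1] := continuous_bounded dom (cc _ cr1).
have cr2 := vcontinuous_cross cX (vcontinuous_cross cX cX1).
have [M2 M20 hM2] := continuous_bounded dom (cc _ cr2).
have dI : is_derive (0 : R) 1 (fun e => I (h e)) (I p).
  apply: (@is_derive_integral _ _ _ dom h p (M1 + M2)) => // e t e1 tI.
  have -> : h e t - h 0 t - e * p t = e ^+ 2 * (dot v (r1 t)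
      + e * dot v (cross (X t) (cross (X t) (X1 t)))).
    rewrite /h /p /r1; move: (gamma t) (X t) (g1 t) (X1 t) =>
      x0 y0 x1 y1; vec_ring.
  rewrite normrM ger0_norm ?sqr_ge0 // mulrC ler_wpM2r ?sqr_ge0 //.
  apply: le_trans (ler_normD _ _) _; apply: lerD; first exact: hM1.
  rewrite normrM; apply: le_trans (ler_piMl _ e1) _ => //; exact: hM2.
have dB : is_derive (0 : R) 1 B (dot v (cross (X t0) (cross b (gamma t0)))
    + dot v (cross (gamma t0) (cross b (X t0)))).
  apply: (@quadratic_is_derive _ _ _ `|dot v (cross (X t0) (cross b (X t0)))|).
  move=> e _.
  rewrite (_ : _ - _ = e ^+ 2 * dot v (cross (X t0) (cross b (X t0)))); last first.
    by rewrite /B; move: (gamma t0) (X t0) => x0 y0; vec_ring.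
  by rewrite normrM ger0_norm ?sqr_ge0 // mulrC.
have -> : work gamma 0 v X = 3^-1 * I p
    - 6^-1 * (dot v (cross (X t0) (cross b (gamma t0)))
    + dot v (cross (gamma t0) (cross b (X t0)))).
  pose S' t := dot v (cross (g1 t) (cross (gamma t) (X t))
    + cross (gamma t) (cross (g1 t) (X t))
    + cross (gamma t) (cross (gamma t) (X1 t))).
  have dS (t : R) : is_derive t 1
      (fun t => dot v (cross (gamma t) (cross (gamma t) (X t)))) (S' t).
    apply: is_derive_eq (is_derive_dot (vderive_cst v)
      (vderive_cross d0 (vderive_cross d0 dX)) t) _.
    rewrite /S'; move: (gamma t) (X t) (g1 t) (X1 t) =>
      x0 y0 x1 y1; vec_ring.
  have cS : continuous S'.
    apply: cc; apply: vcontinuousD; [apply: vcontinuousD|];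
      by apply: vcontinuous_cross => //; exact: vcontinuous_cross.
  have := integral_is_derive dom cS dS; rewrite gammaT XT.
  have -> : dot v (cross (Q *m gamma t0 + b) (cross (Q *m gamma t0 + b) (Q *m X t0))) =
      dot v (cross (gamma t0) (cross (gamma t0) (X t0)))
      + dot v (cross (gamma t0) (cross b (X t0))).
    transitivity (dot (Q *m v)
        (cross (Q *m gamma t0) (cross (Q *m gamma t0) (Q *m X t0)))
      + dot (Q *m v) (cross (Q *m gamma t0) (cross (Q *m b) (Q *m X t0)))
      + dot (cross v b) (cross (Q *m gamma t0 + b) (Q *m X t0))).
      rewrite Qv Qb; move: (Q *m _) (Q *m _) => x y; vec_ring.
    by rewrite vb !cross_SO3 // !dot_SO3 //; vec_ring.
  have -> : I p = I S' + 3 * work gamma 0 v X.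
    rewrite /work (vderiveP d0).2 -integral_continuousZ //.
    rewrite -integral_continuousD //; last first.
      by move=> t; apply: cvgMr; exact: continuous_work.
    apply: eq_Rintegral => t _; rewrite /p /S' /killing.
    by move: (gamma t) (X t) (g1 t) (X1 t) =>
      x0 y0 x1 y1; vec_ring.
  have -> : dot v (cross (X t0) (cross b (gamma t0))) =
      dot v (cross (gamma t0) (cross b (X t0)))
      - dot (cross v b) (cross (gamma t0) (X t0)).
    by move: (gamma t0) (X t0) => x0 y0; vec_ring.
  rewrite vb (_ : dot 0 _ = 0); last by vec_ring.
  by move=> ->; field.
exact: is_deriveB (is_deriveZ 3^-1 dI) (is_deriveZ 6^-1 dB).
Qed.

(** The left-hand side is [(w - 1) ^+ 2 / 2], and [u = (w - 1) * (w + 1)]. *)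
Let sqrt_affine_bound (u w : R) : 0 <= w -> w ^+ 2 = 1 + u ->
  `|w - 1 - u / 2| <= u ^+ 2 / 2.
Proof.
move=> w0 wu; have -> : u = w ^+ 2 - 1 by rewrite wu; ring.
have -> : w - 1 - (w ^+ 2 - 1) / 2 = - ((w - 1) ^+ 2 / 2) by field.
rewrite normrN ger0_norm ?divr_ge0 ?sqr_ge0 //.
have -> : w ^+ 2 - 1 = (w - 1) * (w + 1) by ring.
rewrite ler_wpM2r ?invr_ge0 // exprMn ler_peMr ?sqr_ge0 //.
by rewrite exprn_ege1 // lerDr.
Qed.

Hypothesis unit_speed : forall t, dot (g1 t) (g1 t) = 1.

(** The speed of [gamma + e X] is the square root of
    [1 + 2 e <gamma', X'> + e^2 |X'|^2], which is expanded with a uniform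
    remainder; then integrate by parts. *)
Lemma differential_length :
  differential (curve_length T0 t0) gamma X =
  - I (fun t => dot (X t) (g2 t)).
Proof.
apply: differentialE.
pose h e t := 1 * speed (fun t => gamma t + e *: X t) t.
pose p t := dot (g1 t) (X1 t).
pose q t := dot (X1 t) (X1 t).
have cp : continuous p by exact: continuous_dot.
have cq : continuous q by exact: continuous_dot.
have hE e t : h e t = Num.sqrt (dot (g1 t + e *: X1 t)
    (g1 t + e *: X1 t)).
  by rewrite /h mul1r /speed varE.
have ch e : continuous (h e).
  rewrite (funext (hE e)) => t.
  apply: (@continuous_comp _ _ _ (fun t => dot _ _) Num.sqrt);
    last exact: sqrt_continuous.
  by apply: continuous_dot; exact: cvar1.
have [Mp Mp0 hMp] := continuous_bounded dom cp.
have [Mq Mq0 hMq] := continuous_bounded dom cq.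
have dI : is_derive (0 : R) 1 (fun e => I (h e)) (I p).
  apply: (@is_derive_integral _ _ _ dom h p ((2 * Mp + Mq) ^+ 2 / 2 + Mq / 2)) => //.
  move=> e t e1 tI.
  have h0 : h 0 t = 1.
    by rewrite hE scale0r addr0 unit_speed sqrtr1.
  pose u := 2 * e * p t + e ^+ 2 * q t.
  have hu : h e t ^+ 2 = 1 + u.
    rewrite hE sqr_sqrtr ?dotvv_ge0 // /u /p /q.
    rewrite -[X in _ = X + _](unit_speed t).
    by move: (g1 t) (X1 t) => x y; vec_ring.
  have hw : 0 <= h e t by rewrite hE sqrtr_ge0.
  rewrite h0 (_ : _ - _ = (h e t - 1 - u / 2) + e ^+ 2 * (q t / 2)); last first.
    by rewrite /u; field.
  apply: le_trans (ler_normD _ _) _; rewrite [leRHS]mulrDl; apply: lerD.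
    apply: le_trans (sqrt_affine_bound hw hu) _.
    rewrite [leRHS]mulrAC ler_wpM2r ?invr_ge0 //.
    rewrite -[u ^+ 2]real_normK ?num_real // -[e ^+ 2]real_normK ?num_real //.
    rewrite -exprMn lerXn2r ?nnegrE //; first by rewrite mulr_ge0 ?addr_ge0 ?mulr_ge0.
    rewrite [leRHS]mulrDl; apply: le_trans (ler_normD _ _) _; apply: lerD.
      by rewrite !normrM normr_nat -!mulrA ler_wpM2l // mulrC ler_wpM2r // hMp.
    rewrite normrM normrX mulrC ler_pM ?exprn_ge0 ?hMq //.
    by rewrite expr2 ler_piMl.
  rewrite normrM ger0_norm ?sqr_ge0 // mulrC ler_wpM2r ?sqr_ge0 //.
  by rewrite normrM [`|2^-1|]ger0_norm ?invr_ge0 // ler_wpM2r ?invr_ge0 // hMq.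
suff <- : I p = - I (fun t => dot (X t) (g2 t)) by exact: dI.
have dS (t : R) : is_derive t 1 (fun t => dot (g1 t) (X t))
    (dot (g2 t) (X t) + p t) := is_derive_dot d1 dX t.
have cS : continuous (fun t => dot (g2 t) (X t) + p t).
  by move=> t; apply: cvgD; [exact: continuous_dot|exact: cp].
have := integral_is_derive dom cS dS.
rewrite (monodromy_vderive d0 gammaT) XT dot_SO3 // subrr.
rewrite integral_continuousD //; last exact: continuous_dot.
rewrite (_ : I (fun t => dot (g2 t) (X t)) =
  I (fun t => dot (X t) (g2 t))); first lra.
by apply: eq_Rintegral => t _; vec_ring.
Qed.

End FirstVariation.

(** * Critical curves and Lagrange multipliers *)

Section Lagrange.
Context {R : realType} {V W : lmodType R}.
Variables (S : V -> Prop) (C : W -> Prop) (f : W -> V -> R).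
Hypothesis S_linear : forall k x y, S x -> S y -> S (k *: x + y).
Hypotheses (C0 : C 0) (C_linear : forall k p q, C p -> C q -> C (k *: p + q)).
Hypothesis f_linear_l : forall k p q x, S x -> f (k *: p + q) x = k * f p x + f q x.
Hypothesis f_linear_r : forall k p x y, S x -> S y ->
  f p (k *: x + y) = k * f p x + f p y.

(** Constraints are removed one at a time: if some [x0] satisfies all the others
    but not [f p], then [l - (l x0 / f p x0) f p] vanishes as soon as the others
    do. *)
Lemma lagrange_multipliers (ps : seq W) (l : V -> R) :
  (forall k x y, S x -> S y -> l (k *: x + y) = k * l x + l y) ->
  (forall p, p \in ps -> C p) ->
  (forall x, S x -> (forall p, p \in ps -> f p x = 0) -> l x = 0) ->
  exists2 p, C p & forall x, S x -> l x = f p x.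
Proof.
elim: ps l => [|p ps IHps] l l_linear Cps l0.
  exists 0 => // x Sx; rewrite l0 //.
  by have := f_linear_l (-1) 0 0 Sx; rewrite scaler0 addr0 => ->; ring.
have Cp : C p by apply: Cps; rewrite mem_head.
have {}Cps q : q \in ps -> C q by move=> qps; apply: Cps; rewrite in_cons qps orbT.
have [[x0 [Sx0 psx0 px0]]|nx0] := pselect (exists x0,
    [/\ S x0, forall q, q \in ps -> f q x0 = 0 & f p x0 != 0]); last first.
  apply: IHps => // x Sx psx; apply: l0 => // q; rewrite in_cons => /predU1P[->|].
    by apply/eqP; apply: contrapT => /negP px; apply: nx0; exists x.
  exact: psx.
pose c := l x0 / f p x0.
have [||q Cq lq] := IHps (fun x => l x - c * f p x) _ Cps.
- by move=> k x y Sx Sy; rewrite l_linear // f_linear_r //; ring.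
- move=> x Sx psx.
  have Sy : S (- (f p x / f p x0) *: x0 + x) by exact: S_linear.
  have : l (- (f p x / f p x0) *: x0 + x) = 0.
    apply: l0 => // q; rewrite in_cons => /predU1P[->|qps]; rewrite f_linear_r //.
      by field.
    by rewrite (psx0 q qps) (psx q qps) mulr0 addr0.
  by rewrite l_linear // /c => lx; apply/eqP; rewrite -lx; apply/eqP; field.
exists (c *: p + q); first exact: C_linear.
by move=> x Sx; rewrite f_linear_l // -lq //; ring.
Qed.

End Lagrange.

Section CriticalCurves.
Context {R : realType}.
Variables (T0 t0 : R) (Q : 'M[R]_3) (b : 'cV[R]_3) (gamma : R -> 'cV[R]_3).
Hypotheses (T0_gt0 : 0 < T0) (SQ : SO3 Q) (Qb : Q *m b = b).
Hypothesis gammaM : monodromy_curve T0 Q b gamma.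
Hypothesis gamma_unit : arclength_parametrized gamma.

Local Notation I f := (\int[@lebesgue_measure R]_(t in `[t0, t0 + T0]) f t).
Local Notation vec := 'cV[R]_3.
Implicit Types (a v s : vec) (p q : vec * vec) (X Y : R -> vec).

Let dom : t0 < t0 + T0. Proof. by rewrite ltrDl. Qed.

(** [killing p.1 p.2] is invariant under the rigid motion [(Q, b)], so that its
    magnetic force along the curve is again a tangent variation. *)
Definition invariant_field p : Prop :=
  [/\ Q *m p.1 = p.1, Q *m p.2 = p.2 & cross p.2 b = 0].

Variables g1 g2 : R -> vec.
Hypotheses (g1E : derive1 gamma = g1) (g2E : derive1 g1 = g2).

Let sg : smooth gamma. Proof. by case: gammaM. Qed.
Let sg1 : smooth g1. Proof. by rewrite -g1E; exact: smooth_derive1. Qed.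
Let sg2 : smooth g2. Proof. by rewrite -g2E; exact: smooth_derive1. Qed.
Let d0 : vderive gamma g1.
Proof. by rewrite -g1E; exact: smooth_vderive. Qed.
Let d1 : vderive g1 g2.
Proof. by rewrite -g2E; exact: smooth_vderive. Qed.
Let gammaT t : gamma (t + T0) = Q *m gamma t + b.
Proof. by case: gammaM => _ _ ->. Qed.
Let g1T : forall t, g1 (t + T0) = Q *m g1 t.
Proof. exact: monodromy_vderive d0 gammaT. Qed.
Let g2T : forall t, g2 (t + T0) = Q *m g2 t.
Proof.
by apply: (monodromy_vderive d1 (k := 0)) => t; rewrite addr0; exact: g1T.
Qed.

Let smooth_continuous (X : R -> vec) : smooth X -> vcontinuous X.
Proof. by move=> /smooth_vderive; exact: vderive_continuous. Qed.

Lemma invariant_field_linear k p q : invariant_field p -> invariant_field q ->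
  invariant_field (k *: p + q).
Proof.
move=> [p1 p2 pb] [q1 q2 qb]; split=> /=.
- by rewrite mulmxDr -scalemxAr p1 q1.
- by rewrite mulmxDr -scalemxAr p2 q2.
- transitivity (k *: cross p.2 b + cross q.2 b); first by vec_ring.
  by rewrite pb qb scaler0 addr0.
Qed.

Lemma tangent_linear k X Y : tangent_variation T0 Q X -> tangent_variation T0 Q Y ->
  tangent_variation T0 Q (k *: X + Y).
Proof.
move=> [sX XT] [sY YT]; have -> : k *: X + Y = (fun t => k *: X t + Y t) by [].
split; first exact: smoothD (smoothZ (k := k) sX) sY.
by move=> t; rewrite XT YT mulmxDr -scalemxAr.
Qed.

Lemma tangent_force p : invariant_field p -> tangent_variation T0 Q
  (fun t => cross (g1 t) (killing p.1 p.2 (gamma t))).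
Proof.
case=> p1 p2 pb; split.
  exact: smooth_cross sg1 (smoothD (@smooth_cst _ p.1)
    (smooth_cross (@smooth_cst _ p.2) sg)).
move=> t; rewrite g1T gammaT -cross_SO3 //; congr cross.
rewrite /killing mulmxDr p1 -[in RHS]cross_SO3 // p2.
transitivity (p.1 + cross p.2 (Q *m gamma t) + cross p.2 b).
  by move: (Q *m gamma t) => x; vec_ring.
by rewrite pb addr0.
Qed.

Let continuous_power p X : vcontinuous X -> continuous (fun t =>
  dot (X t) (cross (g1 t) (killing p.1 p.2 (gamma t)))).
Proof.
move=> cX; apply: continuous_dot => //; apply: vcontinuous_cross.
  exact: smooth_continuous.
apply: vcontinuousD; first exact: vcontinuous_cst.
by apply: vcontinuous_cross; [exact: vcontinuous_cst|exact: smooth_continuous].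
Qed.

Let wrk p X := work T0 t0 gamma p.1 p.2 X.

Lemma work_linear_l k p q X : vcontinuous X ->
  wrk (k *: p + q) X = k * wrk p X + wrk q X.
Proof.
move=> cX; rewrite /wrk /work g1E -integral_continuousZ; last exact: continuous_power.
rewrite -integral_continuousD; last exact: continuous_power.
  by apply: eq_Rintegral => t _; rewrite /killing /=;
    move: (X t) (gamma t) (g1 t) => x y z; vec_ring.
by move=> t; apply: cvgMr; exact: continuous_power.
Qed.

Lemma work_linear_r k p X Y : vcontinuous X -> vcontinuous Y ->
  wrk p (k *: X + Y) = k * wrk p X + wrk p Y.
Proof.
move=> cX cY; rewrite /wrk /work g1E -integral_continuousZ; last exact: continuous_power.
rewrite -integral_continuousD; last exact: continuous_power.
  apply: eq_Rintegral => t _.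
  rewrite [(_ + _) t](_ : _ = k *: X t + Y t) //.
  by move: (X t) (Y t) (killing _ _ _) (g1 t) => x y z u; vec_ring.
by move=> t; apply: cvgMr; exact: continuous_power.
Qed.

(** The squared norm of [X] is periodic. *)
Lemma tangent_eq0 X : tangent_variation T0 Q X ->
  (forall t, t0 <= t < t0 + T0 -> X t = 0) -> forall t, X t = 0.
Proof.
move=> [_ XT] X0 t; pose h t := dot (X t) (X t).
have hT : periodic h T0 by move=> x; rewrite /h XT dot_SO3.
suff : h t = 0 by exact: dotvv_eq0.
pose m := Num.floor ((t - t0) / T0).
have tm : t0 <= t - m%:~R * T0 < t0 + T0.
  have := floor_le ((t - t0) / T0); have := lt_succ_floor ((t - t0) / T0).
  rewrite ler_pdivlMr // ltr_pdivrMr // intrD -/m => h1 h2.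
  by apply/andP; split; lra.
have : h (t - m%:~R * T0) = 0 by rewrite /h X0 // dotE !mxE; ring.
case: {tm} m => n.
  by rewrite -(periodicn hT n) -mulr_natl subrK.
rewrite NegzE mulrNz mulNr opprK => <-.
by rewrite -(periodicn hT n.+1) -mulr_natl.
Qed.

(** Lagrange multipliers give [<gamma'' - gamma' x W, X>] of integral zero for
    every tangent variation [X], with [W] an invariant field; then
    [gamma'' - gamma' x W] is itself such an [X]. *)
Lemma stationary_trajectory (ps : seq (vec * vec)) :
  (forall p, p \in ps -> invariant_field p) ->
  (forall X, tangent_variation T0 Q X ->
     (forall p, p \in ps -> wrk p X = 0) -> I (fun t => dot (X t) (g2 t)) = 0) ->
  exists a v, killing_trajectory gamma g1 g2 a v.
Proof.
move=> inv_ps stat.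
have cT X : tangent_variation T0 Q X -> vcontinuous X.
  by case=> sX _; exact: smooth_continuous.
have cg2 : vcontinuous g2 by exact: smooth_continuous.
have inv0 : invariant_field 0.
  by split=> /=; rewrite ?mulmx0 //; vec_ring.
have [|p inv_p lp] := lagrange_multipliers tangent_linear inv0
  invariant_field_linear (fun k p q X TX => work_linear_l k p q (cT X TX))
  (fun k p X Y TX TY => work_linear_r k p (cT X TX) (cT Y TY)) _ inv_ps stat.
  move=> k X Y TX TY.
  rewrite -integral_continuousZ; last exact: (continuous_dot (cT X TX) cg2).
  rewrite -integral_continuousD; last exact: (continuous_dot (cT Y TY) cg2).
    apply: eq_Rintegral => t _.
    rewrite [(_ + _) t](_ : _ = k *: X t + Y t) //.
    by move: (X t) (Y t) (g2 t) => x y z; vec_ring.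
  by move=> t; apply: cvgMr; exact: (continuous_dot (cT X TX) cg2).
exists p.1, p.2.
(* The force of the field found above, and the variation to test with. *)
pose F t := cross (g1 t) (killing p.1 p.2 (gamma t)).
have TF : tangent_variation T0 Q F by exact: tangent_force.
have TX : tangent_variation T0 Q (-1 *: F + g2) by apply: tangent_linear.
have cX := cT _ TX.
pose X : R -> vec := -1 *: F + g2.
suff X0 t : X t = 0.
  move=> t; apply/eqP; rewrite -subr_eq0; apply/eqP; rewrite -[RHS](X0 t).
  by rewrite addrC -scaleN1r.
apply: (tangent_eq0 TX) => {}t tI; apply: dotvv_eq0.
apply: (@integral_eq0_continuous _ _ _ dom (fun t => dot (X t) (X t)) _ _ _ t tI).
- exact: continuous_dot.
- by move=> x; exact: dotvv_ge0.
have := lp _ TX; rewrite /wrk /work g1E => lpX.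
have e : I (fun t => dot (X t) (X t)) = -1 * I (fun t => dot (X t) (F t))
   + I (fun t => dot (X t) (g2 t)).
  rewrite -integral_continuousZ; last exact: continuous_power.
  rewrite -integral_continuousD; last exact: continuous_dot.
    apply: eq_Rintegral => t' _.
    rewrite [in X in dot _ X](_ : X t' = -1 *: F t' + g2 t') //.
    by move: (X t') (F t') (g2 t') => x y z; vec_ring.
  by move=> t'; apply: cvgMr; exact: continuous_power.
by rewrite e lpX; ring.
Qed.

End CriticalCurves.

(** * Well-defined components and invariant fields *)

Section WellDefinedComponents.
Context {R : realType}.
Variables (T0 t0 : R) (Q : 'M[R]_3) (b s : 'cV[R]_3) (gamma : R -> 'cV[R]_3).
Hypotheses (T0_gt0 : 0 < T0) (SQ : SO3 Q) (Qb : Q *m b = b).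
Hypothesis screw : screw_direction Q b s.
Hypothesis gammaM : monodromy_curve T0 Q b gamma.

Local Notation vec := 'cV[R]_3.
Implicit Types (a v : vec) (p q : vec * vec) (X : R -> vec).

Let wrk p X := work T0 t0 gamma p.1 p.2 X.
Let A := area_vector T0 t0 b.
Let V := volume_vector T0 t0 b.

Let sg : smooth gamma. Proof. by case: gammaM. Qed.
Let gammaT t : gamma (t + T0) = Q *m gamma t + b.
Proof. by case: gammaM => _ _ ->. Qed.

Let dA X a : tangent_variation T0 Q X -> Q *m a = a ->
  differential (fun c => dot a (A c)) gamma X = wrk (a, 0) X.
Proof.
move=> [sX XT]; have sg1 := smooth_derive1 sg; have sX1 := smooth_derive1 sX.
exact: (differential_area t0 T0_gt0 SQ Qb (smooth_vderive sg)
  (smooth_vderive sg1) (smooth_vderive sX) (smooth_vderive sX1) gammaT XT).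
Qed.

Let dV X v : tangent_variation T0 Q X -> Q *m v = v -> cross v b = 0 ->
  differential (fun c => dot v (V c)) gamma X = wrk (0, v) X.
Proof.
move=> [sX XT]; have sg1 := smooth_derive1 sg; have sX1 := smooth_derive1 sX.
exact: (differential_volume t0 T0_gt0 SQ Qb (smooth_vderive sg)
  (smooth_vderive sg1) (smooth_vderive sX) (smooth_vderive sX1) gammaT XT).
Qed.

Let entryE (W : (R -> vec) -> vec) i :
  (fun c => W c i 0) = (fun c => dot (delta_mx i 0) (W c)).
Proof.
apply/funext => c; rewrite /dot (bigD1 i) //= big1 => [|j ji].
  by rewrite mxE !eqxx mul1r addr0.
by rewrite mxE (negbTE ji) mul0r.
Qed.

Let parallel u v : dot u u = 1 -> cross u v = 0 -> v = dot u v *: u.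
Proof.
move=> u1 uv; have : cross u (cross u v) = 0 by rewrite uv; vec_ring.
by rewrite double_cross u1 scale1r => /eqP; rewrite subr_eq0 => /eqP.
Qed.

Definition translations : seq (vec * vec) :=
  [seq (delta_mx i 0, 0) | i <- enum 'I_3].
Definition rotations : seq (vec * vec) :=
  [seq (0, delta_mx i 0) | i <- enum 'I_3].

(** One field for each well-defined component: those of the area vector pair
    with translations, those of the volume vector with rotations. *)
Definition field_generators : seq (vec * vec) :=
  if Q != 1%:M then [:: (s, 0); (0, s)]
  else if b != 0 then (0, s) :: translations
  else translations ++ rotations.

Let screw_axis : Q != 1%:M -> enorm s = 1 /\ Q *m s = s.
Proof. by move=> Q1; move: screw; rewrite /screw_direction Q1. Qed.

Let screw_translation : ~~ (Q != 1%:M) -> b != 0 -> s = (enorm b)^-1 *: b.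
Proof. by move=> /negbTE Q1; move: screw; rewrite /screw_direction Q1. Qed.

Let cross_s_b : Q != 1%:M -> cross s b = 0.
Proof.
move=> Q1; have [_ Qs] := screw_axis Q1.
exact: fixed_vectors_parallel Qs Qb.
Qed.

Lemma generators_invariant p : p \in field_generators -> invariant_field Q b p.
Proof.
rewrite /field_generators; have [Q1|Q1] := boolP (Q != 1%:M).
  have [_ Qs] := screw_axis Q1.
  rewrite !inE => /orP[]/eqP->; split; rewrite /= ?mulmx0 //; first by vec_ring.
  exact: cross_s_b.
have -> : Q = 1%:M by apply/eqP; rewrite negbK in Q1.
have cross0 v : cross 0 v = 0 by vec_ring.
have [b0|b0] := boolP (b != 0).
  rewrite inE => /predU1P[->|/mapP[i _ ->]]; split; rewrite /= ?mul1mx ?cross0 //.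
  rewrite (screw_translation Q1 b0).
  by move: (_^-1) => k; vec_ring.
have -> : b = 0 by apply/eqP; rewrite negbK in b0.
have crossv0 v : cross v 0 = 0 by vec_ring.
by rewrite mem_cat => /orP[]/mapP[i _ ->]; split; rewrite /= ?mul1mx ?crossv0.
Qed.

(** By [differential_area] and [differential_volume] the differential of each
    component is the virtual work of the corresponding generator. *)
Lemma well_defined_componentsP X : tangent_variation T0 Q X ->
  (forall F, well_defined_components T0 t0 Q b s F -> differential F gamma X = 0)
  <-> (forall p, p \in field_generators -> wrk p X = 0).
Proof.
move=> TX; have inv := generators_invariant; move: inv.
rewrite /field_generators /well_defined_components.
have [Q1 inv|Q1] := boolP (Q != 1%:M).
  have [/= Qs _ _] := inv (s, 0) (mem_head _ _).
  have sb := cross_s_b Q1.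
  split=> [dF p|wp F].
    rewrite !inE => /orP[]/eqP->; first by rewrite -dA //; apply: dF; left.
    by rewrite -dV //; apply: dF; right.
  case=> /= ->; first by rewrite dA // wp // mem_head.
  by rewrite dV // wp // !inE eqxx orbT.
have [b0 inv|b0 inv] := boolP (b != 0).
  have [/= _ Qs sb] := inv (0, s) (mem_head _ _).
  have dAi i : differential (fun c => A c i 0) gamma X = wrk (delta_mx i 0, 0) X.
    rewrite entryE dA //; have [] // := inv (delta_mx i 0, 0).
    by rewrite inE map_f ?orbT // mem_enum.
  split=> [dF p|wp F].
    rewrite inE => /predU1P[->|/mapP[i _ ->]].
      by rewrite -dV //; apply: dF; right.
    by rewrite -dAi; apply: dF; left; exists i.
  case=> /= [[i ->]|->]; last by rewrite dV // wp // mem_head.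
  by rewrite dAi wp // inE map_f ?orbT // mem_enum.
have mA i : ((delta_mx i 0 : vec), (0 : vec)) \in translations ++ rotations.
  by rewrite mem_cat map_f // mem_enum.
have mV i : ((0 : vec), (delta_mx i 0 : vec)) \in translations ++ rotations.
  by rewrite mem_cat map_f ?orbT // mem_enum.
have dAi i : differential (fun c => A c i 0) gamma X = wrk (delta_mx i 0, 0) X.
  by rewrite entryE dA //; have [] := inv _ (mA i).
have dVi i : differential (fun c => V c i 0) gamma X = wrk (0, delta_mx i 0) X.
  by rewrite entryE dV //; have [] := inv _ (mV i).
split=> [dF p|wp F].
  rewrite mem_cat => /orP[]/mapP[i _ ->].
    by rewrite -dAi; apply: dF; left; exists i.
  by rewrite -dVi; apply: dF; right; exists i.
by case=> /= -[i ->]; rewrite ?dAi ?dVi wp.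
Qed.

(** The generators span the invariant fields: a field invariant under a
    nontrivial rotation is a combination of the rotation about the screw axis
    and the translation along it. *)
Lemma generators_span p X : tangent_variation T0 Q X -> invariant_field Q b p ->
  (forall q, q \in field_generators -> wrk q X = 0) -> wrk p X = 0.
Proof.
case=> sX _; have cX := vderive_continuous (smooth_vderive sX).
have wlin k p' q : wrk p' X = 0 -> wrk q X = 0 -> wrk (k *: p' + q) X = 0.
  move=> p0 q0; rewrite /wrk (work_linear_l t0 gammaM erefl k p' q cX).
  by rewrite [work _ _ _ _ _ _]p0 [work _ _ _ _ _ _]q0 mulr0 addr0.
have w0 : wrk 0 X = 0.
  have := work_linear_l t0 gammaM erefl (-1) 0 0 cX.
  by rewrite scaler0 addr0 mulN1r addNr.
case: p => a v [/= Qa Qv vb] wq.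
have wsplit : wrk (a, 0) X = 0 -> wrk (0, v) X = 0 -> wrk (a, v) X = 0.
  move=> wa wv; rewrite (_ : (a, v) = 1 *: (a, 0) + (0, v)); first exact: wlin.
  by congr pair; rewrite /= scale1r ?addr0 ?add0r.
have waxis u : dot s s = 1 -> cross s u = 0 ->
    (wrk (s, 0) X = 0 -> wrk (u, 0) X = 0) /\ (wrk (0, s) X = 0 -> wrk (0, u) X = 0).
  move=> s1 su; have -> := parallel s1 su; split=> ws.
    rewrite (_ : (_, 0) = dot s u *: (s, 0) + 0); first exact: wlin.
    by congr pair; rewrite /= ?scaler0 addr0.
  rewrite (_ : (0, _) = dot s u *: (0, s) + 0); first exact: wlin.
  by congr pair; rewrite /= ?scaler0 addr0.
have coord (u : vec) : u = u 0 0 *: delta_mx 0 0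
    + (u 1 0 *: delta_mx 1 0 + (u 2 0 *: delta_mx 2 0 + 0)).
  by apply: vec3P; rewrite !mxE /= ?(mulr0, mulr1, addr0, add0r).
have wA : (forall i, wrk (delta_mx i 0, 0) X = 0) -> wrk (a, 0) X = 0.
  move=> wi; rewrite (_ : (a, 0) = a 0 0 *: (delta_mx 0 0, 0)
    + (a 1 0 *: (delta_mx 1 0, 0) + (a 2 0 *: (delta_mx 2 0, 0) + 0))).
    exact: wlin (wi _) (wlin _ _ _ (wi _) (wlin _ _ _ (wi _) w0)).
  by congr pair; rewrite /= ?(scaler0, addr0) // [LHS]coord addr0.
have wV : (forall i, wrk (0, delta_mx i 0) X = 0) -> wrk (0, v) X = 0.
  move=> wi; rewrite (_ : (0, v) = v 0 0 *: (0, delta_mx 0 0)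
    + (v 1 0 *: (0, delta_mx 1 0) + (v 2 0 *: (0, delta_mx 2 0) + 0))).
    exact: wlin (wi _) (wlin _ _ _ (wi _) (wlin _ _ _ (wi _) w0)).
  by congr pair; rewrite /= ?(scaler0, addr0) // [LHS]coord addr0.
move: wq; rewrite /field_generators; have [Q1 wq|Q1] := boolP (Q != 1%:M).
  have [s1 Qs] := screw_axis Q1.
  have ss : dot s s = 1 by rewrite -sqr_enorm s1 expr1n.
  have [wa _] := waxis a ss (fixed_vectors_parallel SQ Q1 Qs Qa).
  have [_ wv] := waxis v ss (fixed_vectors_parallel SQ Q1 Qs Qv).
  by apply: wsplit; [apply: wa|apply: wv]; apply: wq; rewrite !inE eqxx ?orbT.
have [b0 wq|b0 wq] := boolP (b != 0).
  have sE := screw_translation Q1 b0.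
  have nb : enorm b != 0 by apply: contra b0 => /eqP/enorm_eq0 ->.
  have ss : dot s s = 1.
    rewrite sE (_ : dot _ _ = (enorm b)^-1 ^+ 2 * dot b b); last by vec_ring.
    by rewrite -sqr_enorm -exprMn mulVf // expr1n.
  have sv : cross s v = 0.
    rewrite sE (_ : cross _ _ = - (enorm b)^-1 *: cross v b); last by vec_ring.
    by rewrite vb scaler0.
  have [_ wv] := waxis v ss sv.
  apply: wsplit; last by apply: wv; apply: wq; rewrite mem_head.
  by apply: wA => i; apply: wq; rewrite inE map_f ?orbT // mem_enum.
apply: wsplit; [apply: wA|apply: wV] => i; apply: wq;
  by rewrite mem_cat map_f ?orbT // mem_enum.
Qed.

End WellDefinedComponents.

(** Under the monodromy the force is rotated, and the torque is rotated and
    displaced by [- v x b]; both being constant, the field they define is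
    invariant. *)
Lemma conserved_invariant (R : realType) (T0 : R) (Q : 'M[R]_3) (b a v : 'cV[R]_3)
    (g0 g1 g2 g3 : R -> 'cV[R]_3) l1 l2 :
  SO3 Q -> Q *m b = b -> (forall t, g0 (t + T0) = Q *m g0 t + b) ->
  (forall t, g1 (t + T0) = Q *m g1 t) -> (forall t, g2 (t + T0) = Q *m g2 t) ->
  (forall t, g3 (t + T0) = Q *m g3 t) ->
  (forall t, force g1 g2 g3 l1 l2 t = v) -> (forall t, torque g0 g1 g2 l2 v t = a) ->
  invariant_field Q b (a, v).
Proof.
move=> SQ Qb g0T g1T g2T g3T Fv Ma.
have Qv : Q *m v = v.
  rewrite -{2}(Fv (0 + T0)) -(Fv 0) /force g1T g2T g3T dot_SO3 // cross_SO3 //.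
  by rewrite !(mulmxBr, mulmxDr) -!scalemxAr.
have Qa : a = Q *m a - cross v b.
  rewrite -{1}(Ma (0 + T0)) -(Ma 0) /torque g0T g1T g2T cross_SO3 //.
  rewrite mulmxN !mulmxDr -scalemxAr -[Q *m cross v _]cross_SO3 // Qv.
  by move: (Q *m _) (Q *m _) (Q *m _) => x y z; vec_ring.
have vb : cross v b = 0.
  have [Q1|Q1] := eqVneq Q 1%:M; last exact: fixed_vectors_parallel Qv Qb.
  by move: Qa; rewrite Q1 mul1mx => /eqP; rewrite -subr_eq0 opprB addrC subrK => /eqP.
by split=> //=; rewrite [RHS]Qa vb subr0.
Qed.

(** * Elastic curves are the critical curves of length *)

Section MainTheorem.
Context {R : realType}.
Variables (T0 t0 : R) (Q : 'M[R]_3) (b s : 'cV[R]_3) (gamma : R -> 'cV[R]_3).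
Hypotheses (T0_gt0 : 0 < T0) (SQ : SO3 Q) (Qb : Q *m b = b).
Hypothesis screw : screw_direction Q b s.
Hypothesis gammaM : monodromy_curve T0 Q b gamma.
Hypothesis gamma_unit : arclength_parametrized gamma.
Variables g1 g2 g3 g4 : R -> 'cV[R]_3.
Hypotheses (g1E : derive1 gamma = g1) (g2E : derive1 g1 = g2)
  (g3E : derive1 g2 = g3) (g4E : derive1 g3 = g4).

(** On a trajectory of the invariant field [killing a v] the differential of
    length is minus the virtual work of that field. *)
Lemma elastic_critical :
  (exists l1 l2, forall t, elastic_lhs g1 g2 g3 g4 l1 l2 t = 0) <->
  critical_at_fixed T0 Q (curve_length T0 t0)
    (well_defined_components T0 t0 Q b s) gamma.
Proof.
have [sg _ gT] := gammaM.
have sg1 : smooth g1 by rewrite -g1E; exact: smooth_derive1.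
have sg2 : smooth g2 by rewrite -g2E; exact: smooth_derive1.
have sg3 : smooth g3 by rewrite -g3E; exact: smooth_derive1.
have d0 : vderive gamma g1 by rewrite -g1E; exact: smooth_vderive.
have d1 : vderive g1 g2 by rewrite -g2E; exact: smooth_vderive.
have d2 : vderive g2 g3 by rewrite -g3E; exact: smooth_vderive.
have d3 : vderive g3 g4 by rewrite -g4E; exact: smooth_vderive.
have unit t : dot (g1 t) (g1 t) = 1.
  by rewrite -g1E -sqr_enorm [enorm _]gamma_unit expr1n.
have cg2 := vderive_continuous d2.
have dL X : tangent_variation T0 Q X ->
    differential (curve_length T0 t0) gamma X =
    - \int[@lebesgue_measure R]_(t in `[t0, t0 + T0]) dot (X t) (g2 t).
  move=> [sX XT].
  exact: (differential_length t0 T0_gt0 SQ d0 d1 cg2 (smooth_vderive sX)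
    (smooth_vderive (smooth_derive1 sX)) gT XT unit).
split=> [[l1 [l2 ell]] X TX|crit].
  have [a [v [Fv Ma]]] := elastic_conserved d0 d1 d2 d3 unit ell.
  have g1T := monodromy_vderive d0 gT.
  have g2T := monodromy_vderive d1 (k := 0) (fun t => etrans (g1T t) (esym (addr0 _))).
  have g3T := monodromy_vderive d2 (k := 0) (fun t => etrans (g2T t) (esym (addr0 _))).
  have inv := conserved_invariant SQ Qb gT g1T g2T g3T Fv Ma.
  have tr := conserved_trajectory d1 unit Ma.
  move/(well_defined_componentsP t0 T0_gt0 SQ Qb screw gammaM TX) => wX.
  have w0 := generators_span SQ screw gammaM TX inv wX.
  rewrite dL // -[RHS]oppr0 -[X in _ = - X]w0 /work g1E; congr (- _).
  by apply: eq_Rintegral => t _; rewrite tr.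
have stat X : tangent_variation T0 Q X ->
    (forall p, p \in field_generators Q b s -> work T0 t0 gamma p.1 p.2 X = 0) ->
    \int[@lebesgue_measure R]_(t in `[t0, t0 + T0]) dot (X t) (g2 t) = 0.
  move=> TX wX; apply/eqP; rewrite -oppr_eq0 -dL //; apply/eqP; apply: crit => //.
  exact/(well_defined_componentsP t0 T0_gt0 SQ Qb screw gammaM TX).
have [a [v tr]] := stationary_trajectory T0_gt0 SQ gammaM g1E g2E
  (generators_invariant SQ Qb screw) stat.
exact: (trajectory_elastic d0 d1 d2 d3 unit tr).
Qed.

End MainTheorem.

Theorem corollary2p6 (R : realType) (T0 : R) (hT0 : 0 < T0)
    (Q : 'M[R]_3) (b s : 'cV[R]_3) (hQ : SO3 Q)
    (hb : Q != 1%:M -> Q *m b = b) (hs : screw_direction Q b s)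
    (gamma : R -> 'cV[R]_3) (hgamma : monodromy_curve T0 Q b gamma)
    (harc : arclength_parametrized gamma) (t0 : R) :
  elastic gamma <->
  critical_at_fixed T0 Q (curve_length T0 t0)
    (well_defined_components T0 t0 Q b s) gamma.
Proof.
have Qb : Q *m b = b by have [->|/hb//] := eqVneq Q 1%:M; rewrite mul1mx.
exact: (elastic_critical t0 hT0 hQ Qb hs hgamma harc erefl erefl erefl erefl).
Qed.
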